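(* Let $0<\varepsilon<1/2$. There is $p_0(\varepsilon)$ such that for every prime $p>p_0(\varepsilon)$ and all subsets $A,B\subseteq\mathbb{F}_p$ with $|A|,|B|\ge 2$ and $A+B=P_p$, we have $$\left(\frac12-\varepsilon\right)\frac{\varphi(p-1)}{\sqrt{p}}\le |A|,\,|B|\le 3\sqrt{p}.$$
   Context: $\mathbb{F}_p$ is the finite field with $p$ elements. $P_p$ denotes the set of primitive elements of $\mathbb{F}_p$, i.e. the generators of the cyclic group $\mathbb{F}_p^{\times}$. For $A,B\subseteq\mathbb{F}_p$, $A+B=\{a+b: a\in A,\ b\in B\}$. $\varphi$ is Euler's totient function. *)

(* Defs.v *)
From mathcomp Require Import all_boot all_order all_algebra.
Set Implicit Arguments. Unset Strict Implicit. Unset Printing Implicit Defensive.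

(* Set of primitive elements of F_p: generators of the cyclic group F_p^x,
   i.e. primitive (p-1)-th roots of unity in 'F_p. *)
Definition primitive_elts (p : nat) : {set 'F_p} :=
  [set x : 'F_p | primitive_root_of_unity p.-1 x].

Definition sumset (p : nat) (A B : {set 'F_p}) : {set 'F_p} :=
  [set (a + b)%R | a in A, b in B].

(* Main.v *)
Require Import Defs.
From mathcomp Require Import all_boot all_order all_algebra all_field.
From mathcomp Require Import ring lra zify.
Set Implicit Arguments. Unset Strict Implicit. Unset Printing Implicit Defensive.
Import Order.TTheory GRing.Theory Num.Theory.
Local Open Scope ring_scope.

(** Write [P] for the set of primitive elements, [rho = phi(p-1) / (p-1)] and [k = |B|].
    All translates of [A] by elements of [B] consist of quadratic non-residues.  Hence
    the fourth moment of [\sum_(b in B) qc (x + b)], where the quartic character sums are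
    bounded by Hasse's [2 sqrt p], gives [|A| <= 3 p / k^2 + (2 + o(1)) sqrt p].  This is
    the claim unless [k^2 = O(sqrt p)], and since [|A| k >= phi(p-1)] it then shows that
    [k rho = O(1)].  This case is impossible for large [p].  Indeed the elements of [P] at a
    given distance from another element of [P] have density [rho^2], by a second moment over
    pairs of cosets of power residues, so that [k rho >= 1 - o(1)] and
    [|A| >= (1 - o(1)) p / k^2].  On the other hand the sets of [x] for which [x + b] is a
    non-residue for [j] given [b] have density [2^-j] by Stepanov's method, which
    contradicts the previous bound when [k >= 5].  When [k <= 4], the translates of such a
    set [W] by [B] overlap too much to cover [P].  The lower bound follows from the upper
    bound for the other summand and from [|A| |B| >= phi(p-1)].

    Hasse's bound is proved following Manin: over [F(X)], the degrees [d_n] of the abscissas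
    of [Q + n G], with [Q] the Frobenius point and [G] the generic point, satisfy
    [d_(n+1) + d_(n-1) = 2 d_n + 2], so that [n^2 - S n + p = d_n >= 0] for all [n]. *)

(** * Manin's recursion on x-coordinates *)

Section Ladder.
Variables (F : fieldType) (e1 e2 : F).
Hypotheses (two_neq0 : 2 != 0 :> F) (e1_neq0 : e1 != 0) (e2_neq0 : e2 != 0).
Hypothesis e1_neq_e2 : e1 != e2.

Let a : {poly F} := (- (e1 + e2))%:P.
Let b : {poly F} := (e1 * e2)%:P.

(* On [X (X - e1) (X - e2) y^2 = x (x - e1) (x - e2)], the sum and the difference of [(X, 1)]
   and of a point of abscissa [f / g] have abscissas the roots of [v^2 T^2 - w T + u^2]. *)
Definition lad_u (f g : {poly F}) := f * 'X - b * g.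
Definition lad_v (f g : {poly F}) := f - 'X * g.
Definition lad_w (f g : {poly F}) :=
  2 * ((f + 'X * g) * (f * 'X + b * g) + 2 * a * f * 'X * g).
Definition lad_rel (f g f' g' : {poly F}) :=
  lad_v f g ^+ 2 * f' ^+ 2 - lad_w f g * f' * g' + lad_u f g ^+ 2 * g' ^+ 2.

Lemma lad_relC f g f' g' : lad_rel f g f' g' = lad_rel f' g' f g.
Proof. rewrite /lad_rel /lad_u /lad_v /lad_w; ring. Qed.

Lemma coprimep_of_exp (h q : {poly F}) : h %| q ^+ 2 -> coprimep h q -> h %= 1.
Proof.
move=> hq c; have : h %| q * (q * 1) by rewrite mulr1 -expr2.
by rewrite !Gauss_dvdpr // dvdp1 size_poly_eq1.
Qed.

(** A common factor [k] of [u], [v] and [w] is coprime to [g], so it divides ['X^2 - b], then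
    [2 'X + a], hence the discriminant [a^2 - 4 b = (e1 - e2)^2], a nonzero constant. Squares are
    removed first by [coprimep_of_exp]. This keeps the abscissas produced by the recursion in lowest
    terms. *)
Lemma lad_coprime f g h : coprimep f g ->
  h %| lad_u f g ^+ 2 -> h %| lad_v f g ^+ 2 -> h %| lad_w f g -> h %= 1.
Proof.
move=> cfg hu hv hw.
suff k1 k : k %| lad_u f g -> k %| lad_v f g -> k %| lad_w f g -> k %= 1.
  apply: (coprimep_of_exp hu); rewrite /coprimep size_poly_eq1.
  set k := gcdp _ _.
  have kh : k %| h by exact: dvdp_gcdl.
  have ku : k %| lad_u f g by exact: dvdp_gcdr.
  apply: (@coprimep_of_exp _ (lad_v f g)); first exact: dvdp_trans hv.
  rewrite /coprimep size_poly_eq1; apply: k1.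
  - exact: dvdp_trans (dvdp_gcdl _ _) ku.
  - exact: dvdp_gcdr.
  - by apply: dvdp_trans (dvdp_gcdl _ _) (dvdp_trans kh hw).
move=> ku kv kw.
have ckg : coprimep k g.
  rewrite /coprimep -dvdp1 -(eqp_dvdr _ (_ : gcdp f g %= 1)).
    rewrite dvdp_gcd dvdp_gcdr andbT.
    have -> : f = lad_v f g + 'X * g by rewrite /lad_v; ring.
    by rewrite dvdp_add // ?(dvdp_trans (dvdp_gcdl _ _) kv) // dvdp_mull // dvdp_gcdr.
  by rewrite -size_poly_eq1.
have kb : k %| 'X^2 - b.
  have : k %| g * ('X^2 - b).
    have -> : g * ('X^2 - b) = lad_u f g - 'X * lad_v f g.
      by rewrite /lad_u /lad_v; ring.
    by rewrite dvdp_sub // dvdp_mull.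
  by rewrite Gauss_dvdpr.
have ckX : coprimep k 'X.
  apply: (coprimep_dvdr kb).
  rewrite coprimepX /root !hornerE.
  by rewrite expr0n /= sub0r oppr_eq0 mulf_neq0.
have ka : k %| 2 * 'X + a.
  have : k %| g * (g * ('X * ('X * (4%:P * (2 * 'X + a))))).
    have -> : g * (g * ('X * ('X * (4%:P * (2 * 'X + a))))) =
      lad_w f g - lad_v f g * (2 * (f * 'X + b * g) + 4 * 'X * g * 'X + 4 * a * 'X * g)
      + 4 * 'X * g * g * ('X^2 - b).
      rewrite /lad_w /lad_v (_ : 4%:P = 4); last by rewrite -[4]/(4%:R) rmorph_nat.
      ring.
    apply: dvdp_add; last by rewrite dvdp_mull.
    by apply: dvdp_sub => //; rewrite dvdp_mulr.
  rewrite 4?Gauss_dvdpr // mul_polyC dvdpZr //.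
  by rewrite (_ : 4 = 2 * 2) ?mulf_neq0 //; ring.
have : k %| ((e1 - e2) ^+ 2)%:P.
  have -> : ((e1 - e2) ^+ 2)%:P = (2 * 'X + a) * (a - 2 * 'X) + 4 * ('X^2 - b).
    rewrite /a /b !(rmorphN, rmorphM, rmorphD, rmorphXn, rmorphB) /=; ring.
  by apply: dvdp_add; [exact: dvdp_mulr | exact: dvdp_mull].
move=> kc; rewrite -size_poly_eq1 -dvdp1; apply: (dvdp_trans kc).
by rewrite dvdp1 size_polyC expf_eq0 subr_eq0 (negPf e1_neq_e2).
Qed.

Lemma size_lad_u (f g : {poly F}) : (size g < size f)%N -> size (lad_u f g) = (size f).+1.
Proof.
move=> gf; have f0 : f != 0 by rewrite -size_poly_gt0 (leq_trans _ gf).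
rewrite /lad_u size_polyDl size_mulX // size_polyN mul_polyC.
by rewrite (leq_ltn_trans (size_scale_leq _ _)) // ltnW.
Qed.

Lemma size_lad_w (f g : {poly F}) : (size g < size f)%N -> (size (lad_w f g) <= (size f).*2)%N.
Proof.
move=> gf; have f0 : (0 < size f)%N by rewrite (leq_trans _ gf).
have sXg : (size ('X * g)%R <= size f)%N.
  by rewrite (leq_trans (size_polyMleq _ _)) // size_polyX.
have sC (c q : {poly F}) n : (size c <= 1)%N -> (size q <= n)%N -> (size (c * q)%R <= n)%N.
  by move=> c1 qn; rewrite (leq_trans (size_polyMleq _ _)) //; lia.
have s2 : (size (2 : {poly F})%R <= 1)%N by rewrite -polyC_natr size_polyC_leq1.
have sM (q r : {poly F}) n m : (size q <= n)%N -> (size r <= m.+1)%N ->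
    (size (q * r)%R <= n + m)%N.
  by move=> qn rm; rewrite (leq_trans (size_polyMleq _ _)) //; lia.
have sD (q r : {poly F}) n : (size q <= n)%N -> (size r <= n)%N -> (size (q + r)%R <= n)%N.
  by move=> qn rn; rewrite (leq_trans (size_polyD _ _)) // geq_max qn.
rewrite /lad_w -addnn; apply: (sC) => //; apply: (sD).
  apply: (sM); first exact: (sD).
  apply: (sD); first by rewrite size_mulX // -size_poly_gt0.
  by apply: (sC); rewrite ?size_polyC_leq1 // ltnW // ltnW.
have -> : 2 * a * f * 'X * g = 2 * (a * (f * ('X * g))) by ring.
do 2![apply: (sC); rewrite ?size_polyC_leq1 //].
by apply: (sM) => //; rewrite ltnW.
Qed.

Definition lad_inv (f g f' g' : {poly F}) :=
  [/\ coprimep f g, coprimep f' g', (size g < size f)%N, (size g' < size f')%N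
    & lad_rel f g f' g' = 0].

(* The next abscissa is the second root of the quadratic form [lad_rel f g], besides [f' / g']. *)
Lemma lad_step f g f' g' : lad_inv f g f' g' ->
  exists f2 g2, lad_inv f2 g2 f g /\ (size f' + size f2 = (size f).*2.+2)%N.
Proof.
move=> [cfg cfg' sg sg' rel].
have f0 : f != 0 by rewrite -size_poly_gt0 (leq_trans _ sg).
have f'0 : f' != 0 by rewrite -size_poly_gt0 (leq_trans _ sg').
set u : {poly F} := lad_u f g; set v : {poly F} := lad_v f g.
set w : {poly F} := lad_w f g.
(* The divisions that follow factor the form [v^2 T^2 - w T + u^2] as [(g' T - f') (g2 T - f2)]. *)
have E : u ^+ 2 * g' ^+ 2 = f' * (w * g' - v ^+ 2 * f').
  apply/eqP; rewrite -subr_eq0; apply/eqP.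
  by move: rel; rewrite /lad_rel -/u -/v -/w => <-; ring.
have [f2 uE] : exists f2 : {poly F}, u ^+ 2 = f2 * f'.
  apply/dvdpP; have : f' %| u ^+ 2 * g' ^+ 2 by rewrite E dvdp_mulr.
  by rewrite Gauss_dvdpl // coprimep_expr.
have E2 : g' * (w - f2 * g') = f' * v ^+ 2.
  apply: (mulfI f'0); rewrite uE in E.
  have -> : f' * (g' * (w - f2 * g')) = f' * (w * g') - f2 * f' * g' ^+ 2 by ring.
  by rewrite E; ring.
have [g2 wE] : exists g2 : {poly F}, w - f2 * g' = g2 * f'.
  apply/dvdpP; have : f' %| g' * (w - f2 * g') by rewrite E2 dvdp_mulr.
  by rewrite Gauss_dvdpr.
have vE : v ^+ 2 = g' * g2.
  by apply: (mulfI f'0); rewrite -E2 wE; ring.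
have {}wE : w = f2 * g' + g2 * f' by rewrite -wE; ring.
have size_u : size u = (size f).+1 := size_lad_u sg.
have u0 : u != 0 by rewrite -size_poly_gt0 size_u.
have f20 : f2 != 0 by apply: contraNneq (expf_neq0 2 u0) => E'; rewrite uE E' mul0r.
have su : (size f2 + size f' = (size f).*2.+2)%N.
  have : size (u ^+ 2) = size (f2 * f') by rewrite uE.
  rewrite expr2 !size_mul // size_u.
  by move: f20 f'0; rewrite -!size_poly_gt0; move: (size f) (size f') (size f2); lia.
exists f2, g2; split; last by rewrite addnC.
split=> //.
- rewrite /coprimep size_poly_eq1; apply: (lad_coprime cfg).
  + by rewrite -/u uE dvdp_mulr // dvdp_gcdl.
  + by rewrite -/v vE dvdp_mull // dvdp_gcdr.
  + by rewrite -/w wE dvdp_add // dvdp_mulr // ?dvdp_gcdl ?dvdp_gcdr.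
(* Otherwise [g2 * f'] would be the dominant term of [w] and its degree would exceed the bound of
   [size_lad_w]. *)
- rewrite ltnNge; apply/negP => sfg.
  have g20 : g2 != 0 by rewrite -size_poly_gt0 (leq_trans _ sfg) // size_poly_gt0.
  have lt_fg : (size (f2 * g')%R < size (g2 * f')%R)%N.
    rewrite (leq_ltn_trans (size_polyMleq _ _)) // size_mul //.
    by move: su sfg sg'; move: (size g') (size f') (size f2) (size g2) (size f); lia.
  have := size_lad_w sg; rewrite -/w wE addrC size_polyDl // size_mul //.
  by move: su sfg; move: (size f) (size f') (size f2) (size g2); lia.
- rewrite lad_relC /lad_rel -/u -/v -/w uE vE wE; ring.
Qed.

(** The degrees of the successive numerators have constant second difference 2. Here [f] has index 0
    and [f'] index -1, so the [n]-th degree is [n^2 - S n + d], and a degree is nonnegative. *)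
Lemma lad_iter (d S : int) f g f' g' : lad_inv f g f' g' ->
  (size f)%:Z = d + 1 -> (size f')%:Z = d + S + 2 ->
  forall n : nat, 0 <= n%:Z ^+ 2 - S * n%:Z + d.
Proof.
move=> inv sf sf' n.
suff: exists f g f' g', [/\ lad_inv f g f' g', (size f)%:Z = n%:Z ^+ 2 - S * n%:Z + d + 1
    & (size f')%:Z = (n%:Z - 1) ^+ 2 - S * (n%:Z - 1) + d + 1].
  move=> [k [l [k' [l' [[_ _ + _ _] + _]]]]].
  by case: (size k) => // m _ E; rewrite -(lerD2r 1) -E.
elim: n => [|n [k [l [k' [l' [kinv sk sk']]]]]].
  by exists f, g, f', g'; split=> //; rewrite ?sf ?sf'; ring.
have [k2 [l2 [inv2 s2]]] := lad_step kinv.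
exists k2, l2, k, l; split => //; last by rewrite sk intS; ring.
have -> : (size k2)%:Z = ((size k).*2.+2)%:Z - (size k')%:Z by rewrite -s2 PoszD; ring.
by rewrite -addnn !intS PoszD sk sk'; ring.
Qed.

End Ladder.

(** * The quadratic character *)

(** The Legendre symbol, defined through Euler's criterion and with values in [int], so that
    character sums are integers. *)
Definition qc (F : finFieldType) (x : F) : int :=
  if x == 0 then 0 else if x ^+ (#|F|./2) == 1 then 1 else -1.

Section QuadraticCharacter.
Variable F : finFieldType.
Hypotheses (F_prime : prime #|F|) (F_gt2 : (2 < #|F|)%N).
Local Notation p := #|F|.
Local Notation h := (#|F|./2).
Implicit Types x y : F.

Lemma card_half : p = h.*2.+1.
Proof.
have [p2|po] := even_prime F_prime; first by move: F_gt2; rewrite p2.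
by rewrite -[LHS]odd_double_half po.
Qed.

Lemma char_neq2 : 2 != 0 :> F.
Proof.
have pF : p \in [pchar F] by apply: (@card_finPcharP F p 1); rewrite ?expn1.
by rewrite -(dvdn_pcharf pF) gtnNdvd.
Qed.

Lemma exp_half_sq x : x != 0 -> (x ^+ h) ^+ 2 = 1.
Proof.
move=> x0; apply: (mulfI x0).
by rewrite mulr1 -exprM muln2 -exprS -card_half expf_card.
Qed.

Lemma exp_half x : x ^+ h = (qc x)%:~R.
Proof.
rewrite /qc; case: eqP => [->|/eqP x0].
  by rewrite expr0n; move: card_half F_gt2; case: h => //= ->.
case: eqP => // xh; have /eqP := exp_half_sq x0.
by rewrite sqrf_eq1 => /orP[/eqP|/eqP ->].
Qed.

Lemma qcP x : [\/ [/\ x = 0, qc x = 0 & x ^+ h = 0], [/\ x != 0, qc x = 1 & x ^+ h = 1]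
   | [/\ x != 0, qc x = -1 & x ^+ h = -1]].
Proof.
have := exp_half x; rewrite /qc; case: eqP => [->|/eqP x0] E; first by constructor 1.
by move: E; case: eqP => [->|_] E; [constructor 2|constructor 3].
Qed.

(** Such integers differ by at most 2, and 2 is nonzero in [F]; this transfers identities between
    powers in [F] to [qc]. *)
Lemma qc_inj (m n : int) : m \in [:: 0; 1; -1] -> n \in [:: 0; 1; -1] ->
  m%:~R = n%:~R :> F -> m = n.
Proof.
move=> hm hn /eqP; rewrite -subr_eq0 -rmorphB /= => E; apply/eqP; rewrite -subr_eq0.
have : m - n \in [:: 0; 1; -1; 2; -2].
  by move: hm hn; rewrite !inE => /or3P[]/eqP-> /or3P[]/eqP->.
rewrite !inE; case/or4P=> [//|/eqP d|/eqP d|/orP[]/eqP d]; move: E; rewrite d.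
- by rewrite oner_eq0.
- by rewrite mulrN1z oppr_eq0 oner_eq0.
- by rewrite (negPf char_neq2).
- by rewrite mulrNz oppr_eq0 (negPf char_neq2).
Qed.

Lemma qc_in x : qc x \in [:: 0; 1; -1].
Proof. by case: (qcP x) => -[_ -> _]; rewrite !inE eqxx ?orbT. Qed.

Lemma qcM x y : qc (x * y) = qc x * qc y.
Proof.
apply: qc_inj; first exact: qc_in.
  by case: (qcP x) => -[_ -> _]; case: (qcP y) => -[_ -> _].
by rewrite -exp_half exprMn !exp_half rmorphM.
Qed.

Lemma qc0 : qc (0 : F) = 0.
Proof. by rewrite /qc eqxx. Qed.

Lemma qc1 : qc (1 : F) = 1.
Proof. by rewrite /qc oner_eq0 expr1n eqxx. Qed.

Lemma qc_sq x : x != 0 -> qc (x ^+ 2) = 1.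
Proof.
by move=> x0; rewrite expr2 qcM; case: (qcP x) x0 => -[-> -> _] //=; rewrite eqxx.
Qed.

Lemma qc_prod (I : Type) (r : seq I) (P : pred I) (f : I -> F) :
  qc (\prod_(i <- r | P i) f i) = \prod_(i <- r | P i) qc (f i).
Proof. exact: (big_morph _ qcM qc1). Qed.

End QuadraticCharacter.

(** * Hasse's bound for a cubic with three roots *)

Section Hasse.
Variable F : finFieldType.
Hypotheses (F_prime : prime #|F|) (F_gt2 : (2 < #|F|)%N).
Local Notation p := #|F|.
Local Notation h := (#|F|./2).

Lemma prod_XsubC_dvdp (P : pred F) (q : {poly F}) :
  (forall x, P x -> root q x) -> exists r, q = r * \prod_(x | P x) ('X - x%:P).
Proof.
move=> Pq; rewrite -big_filter; apply: uniq_roots_prod_XsubC.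
  by apply/allP => x; rewrite mem_filter => /andP[/Pq].
by rewrite uniq_rootsE filter_uniq // index_enum_uniq.
Qed.

Lemma size_prod_XsubC_pred (P : pred F) :
  size (\prod_(x | P x) ('X - x%:P)) = (#|P|).+1.
Proof.
by rewrite (eq_bigl (mem P)) // -big_enum size_prod_XsubC cardE.
Qed.

Lemma sum_qc (f : F -> F) :
  \sum_x qc (f x) = (#|[pred x | qc (f x) == 1]|)%:Z - (#|[pred x | qc (f x) == -1]|)%:Z.
Proof.
have E (P : pred F) : (#|P|)%:Z = \sum_x (P x)%:Z.
  rewrite -sum1_card rmorph_sum /= big_mkcond; apply: eq_bigr => x _.
  by rewrite unfold_in; case: (P x).
rewrite !E -sumrB; apply: eq_bigr => x _ /=.
by case: (qcP F_prime F_gt2 (f x)) => -[_ -> _].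
Qed.

Lemma card_qc (f : F -> F) :
  p = (#|[pred x | qc (f x) == 0]| + #|[pred x | qc (f x) == 1%R]|
    + #|[pred x | qc (f x) == -1%R]|)%N.
Proof.
have E (P : pred F) : (#|P|) = (\sum_x (P x))%N.
  by rewrite -sum1_card big_mkcond; apply: eq_bigr => x _; rewrite unfold_in; case: (P x).
have -> : p = (\sum_(x : F) 1)%N by rewrite sum1_card.
rewrite !E -!big_split /=; apply: eq_bigr => x _.
by case: (qcP F_prime F_gt2 (f x)) => -[_ -> _].
Qed.

Variables (e1 e2 : F).
Hypotheses (e1_neq0 : e1 != 0) (e2_neq0 : e2 != 0) (e1_neq_e2 : e1 != e2).

Let cub (x : F) := x * (x - e1) * (x - e2).
Let lam : {poly F} := 'X * ('X - e1%:P) * ('X - e2%:P).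
Let a : {poly F} := (- (e1 + e2))%:P.
Let b : {poly F} := (e1 * e2)%:P.

Lemma lam_exp_card : lam ^+ p = 'X^p ^+ 3 + a * 'X^p ^+ 2 + b * 'X^p.
Proof.
have pF : p \in [pchar {poly F}].
  by rewrite pchar_poly; apply: (@card_finPcharP F p 1); rewrite ?expn1.
have Fr (c : F) : ('X - c%:P) ^+ p = 'X^p - c%:P.
  by rewrite -polyCN exprDn_pchar ?pnatE // -rmorphXn /= expf_card.
rewrite /lam !exprMn !Fr /a /b !(rmorphN, rmorphM, rmorphD) /=; ring.
Qed.

(** On the curve [lam(X) y^2 = lam(x)], the recursion starts from the Frobenius point and its
    difference with the generic point. Cancellation in the abscissa of the difference occurs where
    [lam ^+ h] is [-1] or [0], so its degree counts the values of the character and equals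
    [p + S + 1]. *)
Lemma hasse_quadratic_ge0 (S : int) : S = \sum_x qc (cub x) ->
  forall n : nat, 0 <= n%:Z ^+ 2 - S * n%:Z + p%:Z.
Proof.
move=> SE.
set Dp := \prod_(x | qc (cub x) == 1) ('X - x%:P) : {poly F}.
set Dm := \prod_(x | qc (cub x) == -1) ('X - x%:P) : {poly F}.
set D0 := \prod_(x | qc (cub x) == 0) ('X - x%:P) : {poly F}.
have DE : 'X^p - 'X = D0 * Dp * Dm.
  rewrite finField_genPoly (bigID (fun x => qc (cub x) == 0)) /=.
  rewrite [X in _ * X](bigID (fun x => qc (cub x) == 1)) /= mulrA.
  congr (_ * _ * _); apply: eq_bigl => x;
    by case: (qcP F_prime F_gt2 (cub x)) => -[_ -> _].
have hornerlam x : lam.[x] = cub x by rewrite /lam !hornerE.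
have [k1 k1E] : exists k1, lam ^+ h + 1 = k1 * Dm.
  apply: prod_XsubC_dvdp => x /eqP qx.
  by rewrite rootE hornerD horner_exp hornerlam -polyC1 hornerC exp_half // qx addNr.
have [k2 k2E] : exists k2, lam ^+ h - 1 = k2 * Dp.
  apply: prod_XsubC_dvdp => x /eqP qx.
  by rewrite rootE hornerD horner_exp hornerlam -polyC1 -polyCN hornerC exp_half // qx subrr.
have [k0 k0E] : exists k0, lam = k0 * D0.
  apply: prod_XsubC_dvdp => x /eqP qx.
  rewrite /root hornerlam; by case: (qcP F_prime F_gt2 (cub x)) qx => -[Ex -> _] // _; rewrite Ex.
(* [Np / Gp] and [Nm / Gm] are the abscissas, in lowest terms, of the difference and of the
   sum of ['X^p, lam ^+ h] and ['X, 1]; [Gp] has degree [p + S]. *)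
pose c := a + 'X^p + 'X.
pose Np := k0 * k1 ^+ 2 - c * (Dp ^+ 2 * D0); pose Gp := Dp ^+ 2 * D0.
pose Nm := k0 * k2 ^+ 2 - c * (Dm ^+ 2 * D0); pose Gm := Dm ^+ 2 * D0.
pose L := lam ^+ h.
have LE : lam * L ^+ 2 = 'X^p ^+ 3 + a * 'X^p ^+ 2 + b * 'X^p.
  by rewrite -lam_exp_card -exprM muln2 -exprS -card_half.
have lamE : lam = 'X ^+ 3 + a * 'X ^+ 2 + b * 'X.
  rewrite /lam /a /b !(rmorphN, rmorphM, rmorphD) /=; ring.
have NpGm : Np * Gm = lam * (L + 1) ^+ 2 - c * ('X^p - 'X) ^+ 2.
  by rewrite /L k1E DE {1}k0E /Np /Gm; ring.
have NmGp : Nm * Gp = lam * (L - 1) ^+ 2 - c * ('X^p - 'X) ^+ 2.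
  by rewrite /L k2E DE {1}k0E /Nm /Gp; ring.
have GG : Gp * Gm = lad_v 'X^p 1 ^+ 2.
  by rewrite /lad_v mulr1 DE /Gp /Gm; ring.
have wE : Np * Gm + Nm * Gp = lad_w e1 e2 'X^p 1.
  have -> : Np * Gm + Nm * Gp = 2 * (lam * L ^+ 2) + 2 * lam - 2 * c * ('X^p - 'X) ^+ 2.
    by rewrite NpGm NmGp; ring.
  rewrite LE lamE /lad_w -/a -/b /c; ring.
have D_neq0 : lad_v 'X^p 1 != 0 :> {poly F}.
  rewrite /lad_v mulr1 -size_poly_gt0 size_polyDl size_polyXn //.
  by rewrite size_polyN size_polyX ltnS (ltnW F_gt2).
have uE : Np * Nm = lad_u e1 e2 'X^p 1 ^+ 2.
  apply: (mulIf (expf_neq0 2 D_neq0)).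
  rewrite -{1}GG.
  have -> : Np * Nm * (Gp * Gm) = (Np * Gm) * (Nm * Gp) by ring.
  rewrite NpGm NmGp /c.
  have -> : (lam * (L + 1) ^+ 2 - c * ('X^p - 'X) ^+ 2)
    * (lam * (L - 1) ^+ 2 - c * ('X^p - 'X) ^+ 2)
    = (lam * L ^+ 2 + lam - c * ('X^p - 'X) ^+ 2) ^+ 2 - 4 * lam * (lam * L ^+ 2) by ring.
  rewrite LE lamE /lad_u /lad_v -/a -/b /c; ring.
have cop : coprimep 'X^p (1 : {poly F}) by rewrite coprimep1.
have copN : coprimep Np Gp.
  rewrite /coprimep size_poly_eq1.
  apply: (lad_coprime (char_neq2 F_prime F_gt2) e1_neq0 e2_neq0 e1_neq_e2 cop).
  - by rewrite -uE dvdp_mulr // dvdp_gcdl.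
  - by rewrite -GG dvdp_mulr // dvdp_gcdr.
  - rewrite -wE; apply: dvdp_add; first by rewrite dvdp_mulr // dvdp_gcdl.
    by rewrite dvdp_mull // dvdp_gcdr.
have := card_qc cub; move: SE; rewrite sum_qc.
set n1 := #|[pred x | _ == 1]|; set n2 := #|[pred x | _ == -1]|.
set n0 := #|[pred x | _ == 0]| => SE pE.
have D_size (P : pred F) : \prod_(x | P x) ('X - x%:P) != 0.
  by rewrite -size_poly_gt0 size_prod_XsubC_pred.
have sG (P Q : pred F) : size ((\prod_(x | P x) ('X - x%:P)) ^+ 2 *
    \prod_(x | Q x) ('X - x%:P)) = (#|P|.*2 + #|Q|).+1.
  rewrite expr2 !size_mul ?mulf_neq0 // !size_prod_XsubC_pred.
  by move: #|P| #|Q|; lia.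
have sGp : size Gp = (n1.*2 + n0).+1 by exact: sG.
have sGm : size Gm = (n2.*2 + n0).+1 by exact: sG.
(* The terms in ['X^p ^+ 3] cancel in [NpGm], which leaves ['X * 'X^p ^+ 2] as leading term. *)
have sNpGm : size (Np * Gm) = p.*2.+2.
  have -> : Np * Gm = 'X * 'X^p ^+ 2 + (lam * L + lam * L + b * 'X^p + 'X^2 * 'X^p
      + a * ('X * 'X^p) + a * ('X * 'X^p) + b * 'X).
    rewrite NpGm.
    have -> : lam * (L + 1) ^+ 2 = lam * L ^+ 2 + 2 * (lam * L) + lam by ring.
    rewrite LE {2}lamE /c; ring.
  have -> : 'X * 'X^p ^+ 2 = 'X^(p.*2.+1) :> {poly F} by rewrite -exprM -exprS muln2.
  rewrite size_polyDl size_polyXn // ltnS.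
  have sD (q r : {poly F}) n : (size q <= n)%N -> (size r <= n)%N -> (size (q + r)%R <= n)%N.
    by move=> qn rn; rewrite (leq_trans (size_polyD _ _)) // geq_max qn.
  have sC (z : F) (q : {poly F}) n : (size q <= n)%N -> (size (z%:P * q)%R <= n)%N.
    by move=> qn; rewrite mul_polyC (leq_trans (size_scale_leq _ _)).
  have slam : (size (lam * L)%R <= p.*2.+1)%N.
    rewrite /L -exprS (leq_trans (size_poly_exp_leq _ _)) //.
    have -> : size lam = 4.
      by rewrite /lam !size_mul ?mulf_neq0 ?polyXsubC_eq0 ?polyX_eq0 // !size_XsubC size_polyX.
    by move: (card_half F_prime F_gt2) F_gt2; move: p h; lia.
  do !apply: (sD) => //; try apply: (sC); rewrite -?exprS -?exprD ?size_polyXn ?size_polyX //;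
    by move: F_gt2; move: p; lia.
have Np_neq0 : Np != 0.
  by apply: contraTneq isT => E; move: sNpGm; rewrite E mul0r size_poly0.
have sNp : size Np = (n1.*2 + n0).+2.
  have Gm_neq0 : Gm != 0 by rewrite -size_poly_gt0 sGm.
  move: sNpGm; rewrite size_mul // sGm.
  by move: pE; move: p (n0) (n1) (n2) (size Np); lia.
have inv : lad_inv e1 e2 'X^p 1 Np Gp.
  split => //; rewrite ?size_polyXn ?size_poly1 ?sNp ?sGp ?ltnS ?prime_gt0 //.
  by rewrite /lad_rel -uE -wE -GG; ring.
apply: (lad_iter (char_neq2 F_prime F_gt2) e1_neq0 e2_neq0 e1_neq_e2 inv).
  by rewrite size_polyXn intS addrC.
by rewrite sNp SE pE !intS -addnn !PoszD; ring.
Qed.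

End Hasse.

(** * Fourth moment of a shifted character sum *)

Section Moments.
Variable F : finFieldType.
Hypotheses (F_prime : prime #|F|) (F_gt2 : (2 < #|F|)%N).
Local Notation p := #|F|.
Local Notation h := (#|F|./2).
Let qcP := qcP F_prime F_gt2.
Let qcM := qcM F_prime F_gt2.
Let qc_sq := qc_sq F_prime F_gt2.

(** The quadratic polynomial is evaluated at the integer part of [S / 2]; the [+ 1] accounts for the
    rounding when [S] is odd. *)
Lemma hasse_cubic (e1 e2 : F) (S : int) : e1 != 0 -> e2 != 0 -> e1 != e2 ->
  S = \sum_x qc (x * (x - e1) * (x - e2)) -> 0 <= S -> S ^+ 2 <= 4 * p%:Z + 1.
Proof.
move=> e1_0 e2_0 e12 SE; case: S SE => // n SE _.
have := hasse_quadratic_ge0 F_prime F_gt2 e1_0 e2_0 e12 SE n./2.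
have := odd_double_half n; move: (odd n) (n./2) p => b m q <-.
by case: b => /=; rewrite -addnn; nia.
Qed.

Lemma qc_mul_sq (x y : F) : x != 0 -> qc (x ^+ 2 * y) = qc y.
Proof. by move=> x0; rewrite qcM qc_sq ?mul1r. Qed.

(** Inverting [x + b4] and applying an affine change of variable turn the quartic into a cubic with
    roots [0], [e1] and [e2], up to a fourth power. *)
Lemma quartic_bound (b1 b2 b3 b4 : F) (Q : int) : uniq [:: b1; b2; b3; b4] ->
  Q = \sum_x qc ((x + b1) * (x + b2) * (x + b3) * (x + b4)) ->
  0 <= Q + 1 -> (Q + 1) ^+ 2 <= 4 * p%:Z + 1.
Proof.
rewrite /= !inE !negb_or andbT => /and3P[/and3P[b12 b13 b14] /andP[b23 b24] b34] QE Q0.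
pose c1 := b1 - b4; pose c2 := b2 - b4; pose c3 := b3 - b4.
have c1_0 : c1 != 0 by rewrite subr_eq0.
have c2_0 : c2 != 0 by rewrite subr_eq0.
have c3_0 : c3 != 0 by rewrite subr_eq0.
pose k := c1 * c2 * c3.
have k0 : k != 0 by rewrite !mulf_neq0.
pose e1 := (c1^-1 - c2^-1) / k; pose e2 := (c1^-1 - c3^-1) / k.
have inv_neq (x y : F) : x != y -> x^-1 != y^-1 by rewrite (inj_eq invr_inj).
have e1_0 : e1 != 0.
  by rewrite mulf_neq0 ?invr_eq0 // subr_eq0 inv_neq // (inj_eq (addIr _)).
have e2_0 : e2 != 0.
  by rewrite mulf_neq0 ?invr_eq0 // subr_eq0 inv_neq // (inj_eq (addIr _)).
have e12 : e1 != e2.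
  rewrite (inj_eq (mulIf _)) ?invr_eq0 // (inj_eq (addrI _)) eqr_opp inv_neq //.
  by rewrite (inj_eq (addIr _)).
apply: (hasse_cubic e1_0 e2_0 e12 _ Q0).
pose z w := k * w - c1^-1.
pose g w := (z w)^-1 - b4.
have g_inj : injective g.
  by move=> x y /addIr/invr_inj/addIr/(mulfI k0).
have g_bij := injF_bij g_inj.
pose w0 := (c1 * k)^-1.
have zw0 w : (z w == 0) = (w == w0).
  have -> : z w = k * (w - w0) by rewrite /z /w0; field; rewrite c1_0 k0.
  by rewrite mulf_eq0 (negPf k0) subr_eq0.
rewrite QE (reindex g) /=; last exact: onW_bij.
rewrite (bigD1 w0) // [RHS](bigD1 w0) //=.
(* The summands at [w0] differ. The cubic is a nonzero square there, whereas [g w0 = - b4], because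
   [0^-1 = 0], is a root of the quartic. This is the [+ 1] in the statement. *)
have -> : qc (w0 * (w0 - e1) * (w0 - e2)) = 1.
  have -> : w0 * (w0 - e1) * (w0 - e2) = (k^-1 ^+ 2) ^+ 2.
    by rewrite /w0 /e1 /e2 /k; field; rewrite c1_0 c2_0 c3_0.
  by rewrite qc_sq // expf_neq0 ?invr_eq0.
have -> : g w0 = - b4.
  by apply/eqP; rewrite /g -[X in _ == X]add0r (inj_eq (addIr _)) invr_eq0 zw0.
rewrite addNr mulr0 qc0 add0r addrC; congr (_ + _).
apply: eq_bigr => w; rewrite -zw0 => zw.
have -> : (g w + b1) * (g w + b2) * (g w + b3) * (g w + b4)
  = ((k / z w) ^+ 2) ^+ 2 * (w * (w - e1) * (w - e2)).
  have -> : g w + b4 = (z w)^-1 by rewrite subrK.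
  have -> : g w + b1 = (z w)^-1 * (k * c1 * w).
    rewrite (_ : k * c1 * w = 1 + c1 * z w); last by rewrite /z; field.
    by rewrite /g /c1; field.
  have -> : g w + b2 = (z w)^-1 * (k * c2 * (w - e1)).
    rewrite (_ : k * c2 * (w - e1) = 1 + c2 * z w); last first.
      by rewrite /z /e1 /k; field; rewrite c1_0 c2_0 c3_0.
    by rewrite /g /c2; field.
  have -> : g w + b3 = (z w)^-1 * (k * c3 * (w - e2)).
    rewrite (_ : k * c3 * (w - e2) = 1 + c3 * z w); last first.
      by rewrite /z /e2 /k; field; rewrite c1_0 c2_0 c3_0.
    by rewrite /g /c3; field.
  by rewrite /k; field.
by rewrite qc_mul_sq // expf_neq0 // mulf_neq0 ?invr_eq0.
Qed.

(** A non-residue [g] exists because ['X^h - 1] has at most [h < p - 1] roots; multiplication by [g]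
    permutes [F] and changes the sign of the sum. *)
Lemma sum_qc0 : \sum_(x : F) qc x = 0.
Proof.
have [g g0 gN] : exists2 g : F, g != 0 & qc g = -1.
  case: (pickP [pred g : F | qc g == -1]) => [g /eqP gN|none].
    by exists g => //; apply: contraTneq isT => g0; rewrite g0 qc0 in gN.
  have : ((#|F|).-1 <= h)%N.
    have sz : size ('X^h - 1%:P : {poly F}) = h.+1.
      by rewrite size_XnsubC // half_gt0 ltnW.
    rewrite -ltnS -sz -(cardC1 (0 : F)) cardE; apply: max_poly_roots.
    - by rewrite -size_poly_gt0 sz.
    - apply/allP => x; rewrite mem_enum inE => x0.
      rewrite rootE !hornerE.
      case: (qcP x) x0 (none x) => -[-> /= -> ->]; rewrite ?eqxx ?subrr //.
    - exact: enum_uniq.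
  by move: (card_half F_prime F_gt2) F_gt2; move: h => n -> /=; lia.
suff : \sum_(x : F) qc x = - \sum_(x : F) qc x by move: (\sum_x _); lia.
rewrite {1}(reindex (fun x => g * x)) /=; last first.
  by apply: onW_bij; apply: injF_bij; apply: mulfI.
by rewrite -sumrN; apply: eq_bigr => x _; rewrite qcM gN mulN1r.
Qed.

(** The substitution [x = z^-1 - b] replaces the quadratic by the linear [1 + d z], up to squares.
    The complete linear sum is zero, and its term at [z = 0], which is 1, is the one that is
    missing. *)
Lemma sum_qc_pair (b c : F) : b != c -> \sum_x qc ((x + b) * (x + c)) = -1.
Proof.
move=> bc; pose d := c - b.
have d0 : d != 0 by rewrite subr_eq0 eq_sym.
rewrite (reindex (fun z => z^-1 - b)) /=; last first.
  by apply: onW_bij; apply: injF_bij => x y /addIr/invr_inj.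
have := sum_qc0; rewrite (reindex (fun z => 1 + d * z)) /=; last first.
  by apply: onW_bij; apply: injF_bij => x y /addrI/(mulfI d0).
rewrite (bigD1 0) //= mulr0 addr0 qc1 => /eqP; rewrite addrC addr_eq0 => /eqP <-.
rewrite (bigD1 0) //= invr0 add0r addNr mul0r qc0 add0r.
apply: eq_bigr => z z0.
have -> : (z^-1 - b + b) * (z^-1 - b + c) = z^-1 ^+ 2 * (1 + d * z).
  by rewrite /d; field.
by rewrite qc_mul_sq // invr_eq0.
Qed.

Lemma qc_le x : qc (x : F) <= 1.
Proof. by case: (qcP x) => -[_ -> _]. Qed.
Lemma qc_ge x : -1 <= qc (x : F).
Proof. by case: (qcP x) => -[_ -> _]. Qed.

Lemma sum_qc_square_pair (b c d : F) : c != d ->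
  \sum_x qc ((x + b) * (x + b) * (x + c) * (x + d)) <= 0.
Proof.
move=> cd; rewrite (bigD1 (- b)) //= addNr !mul0r qc0 add0r.
have := sum_qc_pair cd; rewrite (bigD1 (- b)) //=.
rewrite [X in _ -> X <= _](eq_bigr (fun x => qc ((x + c) * (x + d)))); last first.
  move=> x xb; rewrite -mulrA -expr2 qc_mul_sq //.
  by rewrite -[x + b]opprK oppr_eq0 opprD addrC subr_eq0 eq_sym.
have := qc_ge ((- b + c) * (- b + d)).
by move: (qc _) (\sum_(_ | _) _); lia.
Qed.

(** If the shifts agree in pairs, the sum is bounded trivially by [p]; if they are distinct, by [M].
    Otherwise two of them agree and the other two differ from each other, and the sum is
    nonpositive. *)
Lemma quadruple_bound (b1 b2 b3 b4 : F) (M : int) : 0 <= M ->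
  (forall b1 b2 b3 b4 : F, uniq [:: b1; b2; b3; b4] ->
    \sum_x qc ((x + b1) * (x + b2) * (x + b3) * (x + b4)) <= M) ->
  \sum_x qc ((x + b1) * (x + b2) * (x + b3) * (x + b4)) <=
   p%:Z * (((b1 == b2) && (b3 == b4))%:Z + ((b1 == b3) && (b2 == b4))%:Z
    + ((b1 == b4) && (b2 == b3))%:Z) + M.
Proof.
move=> M0 HM; set S := \sum_x _.
have Sp : S <= p%:Z.
  have -> : p%:Z = \sum_(x : F) 1 by rewrite sumr_const cardT -cardE -natz.
  by apply: ler_sum => x _; exact: qc_le.
set u1 := (b1 == b2) && (b3 == b4); set u2 := (b1 == b3) && (b2 == b4).
set u3 := (b1 == b4) && (b2 == b3).
have [E|] := boolP [|| u1, u2 | u3].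
  have : 1 <= u1%:Z + u2%:Z + u3%:Z.
    by move: E; case: (u1); case: (u2); case: (u3).
  by move: Sp M0; move: (_ + _) p => n q; nia.
rewrite !negb_or => /and3P[h1 h2 h3].
rewrite (negPf h1) (negPf h2) (negPf h3) !addr0 mulr0 add0r.
have [u|] := boolP (uniq [:: b1; b2; b3; b4]); first exact: HM.
have S0 b c d : c != d ->
    (forall x, (x + b1) * (x + b2) * (x + b3) * (x + b4) =
      (x + b) * (x + b) * (x + c) * (x + d)) -> S <= M.
  move=> cd E; apply: le_trans M0.
  by rewrite /S (eq_bigr _ (fun x _ => congr1 (@qc F) (E x))) sum_qc_square_pair.
rewrite /= !inE !negb_or andbT !negb_and !negbK.
move=> /or3P[/or3P[]/eqP E|/orP[]/eqP E|/eqP E]; subst.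
- apply: (S0 b2 b3 b4); first by move: h1; rewrite /u1 eqxx.
  by move=> x; ring.
- apply: (S0 b3 b2 b4); first by move: h2; rewrite /u2 eqxx.
  by move=> x; ring.
- apply: (S0 b4 b2 b3); first by move: h3; rewrite /u3 eqxx.
  by move=> x; ring.
- apply: (S0 b3 b1 b4); first by move: h3; rewrite /u3 eqxx andbT.
  by move=> x; ring.
- apply: (S0 b4 b1 b3); first by move: h2; rewrite /u2 eqxx andbT.
  by move=> x; ring.
- apply: (S0 b4 b1 b2); first by move: h1; rewrite /u1 eqxx andbT.
  by move=> x; ring.
Qed.

(** The main term counts the quadruples of shifts that agree in pairs: three pairings, with
    [#|B| ^ 2] choices each. *)
Lemma fourth_moment (B : {set F}) (M : int) : 0 <= M ->
  (forall b1 b2 b3 b4 : F, uniq [:: b1; b2; b3; b4] ->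
    \sum_x qc ((x + b1) * (x + b2) * (x + b3) * (x + b4)) <= M) ->
  \sum_x (\sum_(b in B) qc (x + b)) ^+ 4 <=
    3 * (#|B|)%:Z ^+ 2 * p%:Z + (#|B|)%:Z ^+ 4 * M.
Proof.
move=> M0 HM.
have -> : \sum_x (\sum_(b in B) qc (x + b)) ^+ 4 =
  \sum_(b1 in B) \sum_(b2 in B) \sum_(b3 in B) \sum_(b4 in B)
    \sum_x qc ((x + b1) * (x + b2) * (x + b3) * (x + b4)).
  have E x : (\sum_(b in B) qc (x + b)) ^+ 4 =
      \sum_(b1 in B) \sum_(b2 in B) \sum_(b3 in B) \sum_(b4 in B)
        qc ((x + b1) * (x + b2) * (x + b3) * (x + b4)).
    set T := \sum_(b in B) qc (x + b).
    transitivity (\sum_(b1 in B) qc (x + b1) * T ^+ 3); first by rewrite -mulr_suml -exprS.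
    apply: eq_bigr => b1 _.
    transitivity (\sum_(b2 in B) qc (x + b1) * qc (x + b2) * T ^+ 2).
      by rewrite -mulr_suml -mulr_sumr -/T; ring.
    apply: eq_bigr => b2 _.
    transitivity (\sum_(b3 in B) qc (x + b1) * qc (x + b2) * qc (x + b3) * T).
      by rewrite -mulr_suml -mulr_sumr -/T; ring.
    by apply: eq_bigr => b3 _; rewrite mulr_sumr; apply: eq_bigr => b4 _; rewrite !qcM.
  rewrite (eq_bigr _ (fun x _ => E x)).
  by do 4!(rewrite exchange_big /=; apply: eq_bigr => ? _).
set k := (#|B|)%:Z.
have -> : 3 * k ^+ 2 * p%:Z + k ^+ 4 * M = \sum_(b1 in B) \sum_(b2 in B) \sum_(b3 in B)
   \sum_(b4 in B) (p%:Z * (((b1 == b2) && (b3 == b4))%:Z + ((b1 == b3) && (b2 == b4))%:Z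
    + ((b1 == b4) && (b2 == b3))%:Z) + M).
  have S1 b : b \in B -> \sum_(c in B) (b == c)%:Z = 1.
    move=> bB; rewrite (bigD1 b) //= eqxx big1 ?addr0 // => c /andP[_].
    by rewrite eq_sym => /negPf ->.
  have Sk (c : int) : \sum_(b in B) c = k * c by rewrite sumr_const -mulr_natl natz.
  have mulb (b c : bool) : (b && c)%:Z = b%:Z * c%:Z by case: b c => [] [].
  transitivity (\sum_(b1 in B) (3 * k * p%:Z + k ^+ 3 * M)); first by rewrite Sk; ring.
  apply: eq_bigr => b1 b1B.
  transitivity (\sum_(b2 in B) ((b1 == b2)%:Z * k * p%:Z + 2 * p%:Z + k ^+ 2 * M)).
    by rewrite !big_split /= !Sk -!mulr_suml S1 //; ring.
  apply: eq_bigr => b2 b2B.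
  transitivity (\sum_(b3 in B) ((b1 == b2)%:Z * p%:Z + (b1 == b3)%:Z * p%:Z
      + (b2 == b3)%:Z * p%:Z + k * M)).
    by rewrite !big_split /= !Sk -!mulr_suml !S1 //; ring.
  apply: eq_bigr => b3 b3B.
  under [RHS]eq_bigr => b4 _ do rewrite !mulb !mulrDr.
  rewrite !big_split /= !Sk -!mulr_sumr -!mulr_suml !S1 //; ring.
do 4!(apply: ler_sum => ? _); exact: quadruple_bound.
Qed.

End Moments.

(** * Stepanov's method *)

(** A dimension count by pigeonhole: with more coefficients than conditions two families have the
    same image, and their difference lies in the kernel. *)
Lemma additive_kernel (F : finFieldType) (I K : finType)
    (phi : {ffun I -> F} -> {ffun K -> F}) :
  (forall c d, phi (c - d) = phi c - phi d) -> (#|K| < #|I|)%N ->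
  exists2 c, c != 0 & phi c = 0.
Proof.
move=> phiB KI.
have ninj : ~ injective phi.
  move=> /leq_card; rewrite !card_ffun leq_exp2l ?finNzRing_gt1 //.
  by rewrite leqNgt KI.
case: (pickP (fun cd => (cd.1 != cd.2) && (phi cd.1 == phi cd.2))) => [[c d] /= /andP[cd /eqP E]|H].
  by exists (c - d); rewrite ?subr_eq0 // phiB E subrr.
by case: ninj => c d E; have /= := H (c, d); rewrite E eqxx andbT => /negbFE/eqP.
Qed.

Lemma size_derivn_leq (R : nzSemiRingType) (q : {poly R}) k : (size q^`(k) <= size q)%N.
Proof.
elim: k => // k IH; rewrite derivnS (leq_trans (size_poly _ _)) //.
exact: leq_trans (leq_pred _) IH.
Qed.

Section RootMultiplicity.
Variables (F : fieldType) (p : nat).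
Hypothesis pF : p \in [pchar F].

(** Taylor expansion at [x]. Ordinary derivatives detect multiplicities only up to [p], since the
    factorials [k!] with [k < M] have to be invertible. *)
Lemma dvdp_XsubC_exp_derivn (R : {poly F}) (x : F) (M : nat) : (M <= p)%N ->
  (forall k, (k < M)%N -> root R^`(k) x) -> ('X - x%:P) ^+ M %| R.
Proof.
move=> Mp HR.
have fact_neq0 k : (k < M)%N -> (k`!)%:R != 0 :> F.
  move=> kM; elim: k kM => [|k IH] kM; first by rewrite oner_neq0.
  rewrite factS natrM mulf_neq0 ?IH ?(ltnW kM) //.
  by rewrite -(dvdn_pcharf pF) gtnNdvd // (leq_trans kM).
have E : R = \sum_(i < size R) (R^`N(i).[x])%:P * ('X - x%:P) ^+ i.
  have {1}-> : R = R \Po 'X by rewrite comp_polyXr.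
  rewrite /comp_poly -[X in _.[X]](addrNK x%:P) addrC (nderiv_taylor _ (mulrC _ _)).
  rewrite size_map_polyC; apply: eq_bigr => i _.
  by rewrite nderivn_map horner_map.
rewrite E; apply: (big_ind (fun q => _ %| q)) => [|u v|i _]; [exact: dvdp0 | exact: dvdp_add |].
have [iM|Mi] := ltnP i M; last by rewrite dvdp_mull // dvdp_exp2l.
have : (R^`(i)).[x] == 0 by exact: HR.
rewrite nderivn_def hornerMn -mulr_natr mulf_eq0 (negPf (fact_neq0 _ iM)) orbF.
by move/eqP => ->; rewrite mul0r dvdp0.
Qed.

Lemma size_roots_multiplicity (R : {poly F}) (rs : seq F) (M : nat) : R != 0 ->
  uniq rs -> (forall x, x \in rs -> ('X - x%:P) ^+ M %| R) ->
  (M * size rs < size R)%N.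
Proof.
move=> R0 urs HR.
have D : \prod_(x <- rs) ('X - x%:P) ^+ M %| R.
  elim: rs urs HR => [|x rs IH] /=; first by rewrite big_nil dvd1p.
  move=> /andP[xrs urs] HR; rewrite big_cons Gauss_dvdp.
    by rewrite HR ?mem_head // IH // => y yrs; rewrite HR // inE yrs orbT.
  rewrite prodrXl coprimep_expr // coprimep_expl // coprimep_sym.
  by rewrite coprimep_XsubC root_prod_XsubC.
apply: leq_trans (dvdp_leq R0 D).
rewrite prodrXl [X in (_ < X)%N]polySpred ?expf_neq0 ?monic_neq0 ?monic_prod_XsubC //.
by rewrite size_exp size_prod_XsubC mulnC.
Qed.

End RootMultiplicity.

Section Stepanov.
Variable F : finFieldType.
Hypotheses (F_prime : prime #|F|) (F_gt2 : (2 < #|F|)%N).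
Local Notation p := #|F|.
Local Notation h := (#|F|./2).

Let pF : p \in [pchar F].
Proof. by apply: (@card_finPcharP F p 1); rewrite ?expn1. Qed.

Variable T : seq F.
Hypotheses (T_uniq : uniq T) (T_gt0 : (0 < size T)%N) (T_0 : 0 \notin T).
Local Notation m := (size T).

Definition lin_prod : {poly F} := \prod_(s <- T) ('X + s%:P).
Local Notation f := lin_prod.

Lemma lin_prodE : f = \prod_(s <- [seq - s | s <- T]) ('X - s%:P).
Proof. by rewrite big_map; apply: eq_bigr => s _; rewrite polyCN opprK. Qed.

Lemma size_lin_prod : size f = m.+1.
Proof. by rewrite lin_prodE size_prod_XsubC size_map. Qed.

Lemma lin_prod_neq0 : f != 0.
Proof. by rewrite -size_poly_gt0 size_lin_prod. Qed.

Lemma horner_lin_prod x : f.[x] = \prod_(s <- T) (x + s).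
Proof. by rewrite horner_prod; apply: eq_bigr => s _; rewrite !hornerE. Qed.

(** By Frobenius, [f ^+ p] is the constant [f.[0]] modulo ['X^p]. Since [p = 2 h + 1], this
    eliminates [f ^+ h] after squaring. *)
Lemma lin_prod_exp_card : exists g, f ^+ p = (f.[0])%:P + g * 'X^p.
Proof.
have pFX : p \in [pchar {poly F}] by rewrite pchar_poly.
rewrite /lin_prod horner_prod -prodrXl rmorph_prod /=.
elim: T => [|s t [g IH]]; first by exists 0; rewrite !big_nil mul0r addr0.
exists (g * 'X^p + \prod_(i <- t) (('X + i%:P).[0])%:P + s%:P * g).
rewrite !big_cons IH exprDn_pchar ?pnatE // -rmorphXn /= expf_card !hornerE; ring.
Qed.

Lemma mup_lin_prod : exists x, mup x f = 1%N.
Proof.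
rewrite lin_prodE; have : uniq [seq - s | s <- T] by rewrite map_inj_uniq //; exact: oppr_inj.
have : (0 < size [seq - s | s <- T])%N by rewrite size_map.
case: [seq - s | s <- T] => // x t _ /= /andP[xt _]; exists x.
rewrite big_cons mupMl ?root_prod_XsubC //.
by rewrite -['X - _]expr1 mup_XsubCX eqxx.
Qed.

Variable D : nat.
Hypothesis D_le : (2 * D + m <= p)%N.

(** Squaring [r = - s * f ^+ h] and multiplying by [f] gives [r ^+ 2 * f = f.[0] *: s ^+ 2] modulo
    ['X^p], an equality because both degrees are below [p]. At a simple root of [f] the
    multiplicities of the two sides have different parities, unless [r] and [s] vanish. *)
Lemma stepanov_indep_mod (r s : {poly F}) : (size r <= D)%N -> (size s <= D)%N ->
  'X^p %| r + s * f ^+ h -> r = 0 /\ s = 0.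
Proof.
move=> rD sD /dvdpP[w E].
have [g fg] := lin_prod_exp_card.
have f0 : f.[0] != 0.
  rewrite horner_lin_prod prodf_seq_neq0; apply/allP => x xT /=.
  by rewrite add0r; apply: contraNneq T_0 => <-.
have E2 : r ^+ 2 * f = f.[0] *: s ^+ 2.
  apply/eqP; rewrite -subr_eq0 -size_poly_eq0 -leqn0 leqNgt; apply/negP => sz.
  have /dvdpP[k kE] : 'X^p %| r ^+ 2 * f - f.[0] *: s ^+ 2.
    apply/dvdpP; exists (w * (r - s * f ^+ h) * f + g * s ^+ 2).
    have -> : (w * (r - s * f ^+ h) * f + g * s ^+ 2) * 'X^p =
       (w * 'X^p) * (r - s * f ^+ h) * f + (g * 'X^p) * s ^+ 2 by ring.
    have -> : g * 'X^p = f * (f ^+ h) ^+ 2 - (f.[0])%:P.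
      by rewrite -exprM muln2 -exprS -card_half // fg; ring.
    by rewrite -E -mul_polyC; ring.
  move: sz; rewrite kE size_poly_gt0 mulf_eq0 negb_or => /andP[k0 _].
  have : (size (k * 'X^p)%R <= p)%N.
    rewrite -kE (leq_trans (size_polyD _ _)) // size_polyN geq_max.
    apply/andP; split.
      rewrite expr2 (leq_trans (size_polyMleq _ _)) // size_lin_prod.
      have := size_polyMleq r r; move: rD D_le T_gt0.
      by move: (size (r * r)%R) (size r) m p; lia.
    rewrite (leq_trans (size_scale_leq _ _)) // expr2 (leq_trans (size_polyMleq _ _)) //.
    by move: sD D_le; move: (size s) m p; lia.
  rewrite size_mulXn //; move: k0; rewrite -size_poly_gt0.
  by move: (size k) p; lia.
have [r0|r0] := eqVneq r 0.
  split=> //; apply/eqP; move/eqP: E2.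
  by rewrite r0 expr0n mul0r eq_sym scaler_eq0 (negPf f0) /= sqrf_eq0.
have s0 : s != 0.
  apply: contraTneq isT => s0; move/eqP: E2.
  by rewrite s0 expr0n scaler0 mulf_eq0 sqrf_eq0 (negPf r0) (negPf lin_prod_neq0).
have [x xf] := mup_lin_prod.
have := congr1 (mup x) E2; rewrite -mul_polyC.
rewrite mupM ?sqrf_eq0 ?lin_prod_neq0 // xf (@mupMr _ _ (f.[0])%:P); last by rewrite rootC.
by rewrite !expr2 !mupM //; move: (mup x r) (mup x s); lia.
Qed.

(** The lowest block vanishes modulo ['X^p], hence is zero, and the rest is divided by ['X^p]. This
    is what makes the auxiliary polynomial nonzero. *)
Lemma stepanov_indep J (r s : nat -> {poly F}) :
  (forall j, (size (r j) <= D)%N) -> (forall j, (size (s j) <= D)%N) ->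
  \sum_(j < J) (r j + s j * f ^+ h) * 'X^(j * p) = 0 ->
  forall j, (j < J)%N -> r j = 0 /\ s j = 0.
Proof.
elim: J r s => [//|J IH] r s rD sD.
rewrite big_ord_recl /= mul0n expr0 mulr1.
have -> : \sum_(i < J) (r (bump 0 i) + s (bump 0 i) * f ^+ h) * 'X^(bump 0 i * p) =
    (\sum_(i < J) (r i.+1 + s i.+1 * f ^+ h) * 'X^(i * p)) * 'X^p.
  rewrite mulr_suml; apply: eq_bigr => i _.
  by rewrite /bump /= add1n -mulrA -exprD mulSn addnC.
set S := \sum_(i < J) _ => E.
have [r0 s0] : r 0%N = 0 /\ s 0%N = 0.
  apply: stepanov_indep_mod => //.
  by move/eqP: E; rewrite addr_eq0 => /eqP ->; rewrite -mulNr dvdp_mull.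
move: E; rewrite r0 s0 mul0r !add0r => /eqP.
rewrite mulf_eq0 expf_eq0 polyX_eq0 andbF orbF => /eqP S0.
case=> [_|j jJ]; first by split.
by apply: (IH (fun j => r j.+1) (fun j => s j.+1)) => // i.
Qed.

(** What remains of [f ^+ k] times the [k]-th derivative of [s * f ^+ h] once [f ^+ h] is factored
    out, see [stp_derivn]. Its degree is bounded independently of [h]. *)
Fixpoint stp (s : {poly F}) k : {poly F} :=
  if k is k'.+1 then f * (stp s k')^`() + (h%:R - k'%:R) *: (f^`() * stp s k') else s.

Lemma stpB (s t : {poly F}) k : stp (s - t) k = stp s k - stp t k.
Proof.
elim: k => //= k ->; rewrite derivB -!mul_polyC; ring.
Qed.

Lemma size_stp (s : {poly F}) k : (size s <= D)%N -> (size (stp s k) <= D + k * m)%N.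
Proof.
move=> sD; elim: k => [|k IH] /=; first by rewrite addn0.
have d1 (q : {poly F}) : (size (q^`() : {poly F}) <= (size q).-1)%N.
  exact: size_poly.
rewrite (leq_trans (size_polyD _ _)) // geq_max; apply/andP; split.
  rewrite (leq_trans (size_polyMleq _ _)) // size_lin_prod.
  have := d1 (stp s k); move: IH; move: (size (stp s k)) (size _^`()) m; lia.
rewrite (leq_trans (size_scale_leq _ _)) // (leq_trans (size_polyMleq _ _)) //.
have := d1 f; rewrite size_lin_prod; move: IH.
by move: (size (stp s k)) (size _^`()) m; lia.
Qed.

Lemma stp_derivn (s : {poly F}) k : f ^+ k * (s * f ^+ h)^`(k) = f ^+ h * stp s k.
Proof.
elim: k => [|k IH] /=; first by rewrite expr0 mul1r mulrC.
have fk n : f * (f ^+ n)^`() = n%:R%:P * f^`() * f ^+ n.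
  by case: n => [|n]; rewrite ?derivC ?deriv_exp ?mulr0 ?mul0r //= -mulr_natl polyC_natr exprS; ring.
have := congr1 (fun q => f * q^`()) IH; rewrite !derivM -derivnS !mulrDr !mulrA !fk => E.
rewrite exprS -mul_polyC rmorphB /=.
move: E IH; rewrite -!mulrA; set G := _^`(k); set G1 := _^`(k.+1); set S := stp s k => E IH.
have -> : f * (f ^+ k * G1) =
  (k%:R%:P * (f^`() * (f ^+ k * G)) + f * (f ^+ k * G1))
  - k%:R%:P * (f^`() * (f ^+ k * G)) by ring.
by rewrite E IH; ring.
Qed.

(** In characteristic [p], powers of ['X^p] are constants for the derivation. *)
Lemma derivn_mulXp (g : {poly F}) j k : (g * 'X^(j * p))^`(k) = g^`(k) * 'X^(j * p).
Proof.
elim: k => [//|k IH]; rewrite !derivnS IH derivM derivXn.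
have pFX : p \in [pchar {poly F}] by rewrite pchar_poly.
by rewrite -mulr_natr natrM (pcharf0 pFX) !mulr0 addr0.
Qed.

(** A nonzero polynomial [R] vanishes to order [M = 2 J - 1] at each of the [N] points. Its degree
    is at most about [(J - 1/2) p + m p / 2], so [N] is at most [p / 2] up to an error of order
    [m p / J]. *)
Lemma stepanov_count (e : int) (J : nat) : (e == 1) || (e == -1) ->
  (0 < J)%N -> (p <= 2 * D + m + 1)%N -> (12 * J ^ 2 * m + m + 2 <= p)%N ->
  ((2 * J - 1) * (2 * #|[pred x | qc f.[x] == e]|) <= (2 * J - 1) * p + m * p)%N.
Proof.
move=> e1 J_gt0 D_ge J_le; case: J J_gt0 J_le => // J' _; set J := J'.+1 => J_le.
set N := #|_|; set M := (2 * J - 1)%N; set E := (J + D + M * m)%N.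
pose r (c : {ffun bool * 'I_J * 'I_D -> F}) (b : bool) (j : nat) : {poly F} :=
  \sum_(d < D) c (b, inord j, d) *: 'X^d.
have r_size c b j : (size (r c b j) <= D)%N.
  rewrite (leq_trans (size_sum _ _ _)) //; apply/bigmax_leqP => d _.
  by rewrite (leq_trans (size_scale_leq _ _)) // size_polyXn.
have rB c d b j : r (c - d) b j = r c b j - r d b j.
  by rewrite /r -sumrB; apply: eq_bigr => i _; rewrite !ffunE scalerBl.
(* Where [f ^+ h] takes the value [e], [x ^+ p = x] turns [f ^+ k * R^`(k)], for the [R] below,
   into the low degree polynomial [Psi c k], whose vanishing is a linear condition on [c]. *)
pose Psi c k : {poly F} := \sum_(j < J) 'X^j *
   (f ^+ k * (r c true j)^`(k) + e%:~R *: stp (r c false j) k).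
have PsiB c d k : Psi (c - d) k = Psi c k - Psi d k.
  rewrite /Psi -sumrB; apply: eq_bigr => j _.
  by rewrite !rB derivnB stpB -!mul_polyC; ring.
have Psi_size c k : (k < M)%N -> (size (Psi c k) <= E)%N.
  move=> kM; rewrite (leq_trans (size_sum _ _ _)) //; apply/bigmax_leqP => j _.
  rewrite (leq_trans (size_polyMleq _ _)) // size_polyXn.
  have kmM : (k * m <= M * m)%N by rewrite leq_mul2r (ltnW kM) orbT.
  suff : (size (f ^+ k * (r c true j)^`(k) + e%:~R *: stp (r c false j) k)%R <= D + k * m)%N.
    by move: kmM (ltn_ord j); rewrite /E; move: (size _) (k * m)%N (M * m)%N; lia.
  rewrite (leq_trans (size_polyD _ _)) // geq_max; apply/andP; split.
    rewrite (leq_trans (size_polyMleq _ _)) //.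
    have := size_poly_exp_leq f k; rewrite size_lin_prod /= => fk.
    have : (size (r c true j)^`(k) <= D)%N.
      by rewrite (leq_trans (size_derivn_leq _ _)).
    by move: fk; rewrite mulnC; move: (size _) (size _) (k * m)%N; lia.
  by rewrite (leq_trans (size_scale_leq _ _)) // size_stp.
pose phi c : {ffun 'I_M * 'I_E -> F} :=
  [ffun ke : 'I_M * 'I_E => (Psi c ke.1)`_(ke.2)].
have [||c c0 phic] := @additive_kernel F _ _ phi.
- by move=> c d; apply/ffunP => ke; rewrite !ffunE PsiB coefB.
(* There are [2 J D] coefficients for [M E] conditions. As [D] is about [p / 2], the assumption
   [12 J^2 m + m + 2 <= p] leaves more coefficients than conditions. *)
- rewrite !card_prod !card_ord card_bool /E /M.
  move: J_le D_ge T_gt0; rewrite /J; move: m p D; clear; nia.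
have Psi0 k : (k < M)%N -> Psi c k = 0.
  move=> kM; apply/polyP => i; rewrite coef0.
  have [iE|Ei] := ltnP i E; last by rewrite nth_default // (leq_trans (Psi_size _ _ kM)).
  by have /ffunP/(_ (Ordinal kM, Ordinal iE)) := phic; rewrite !ffunE.
pose R := \sum_(j < J) (r c true j + r c false j * f ^+ h) * 'X^(j * p).
have R0 : R != 0.
  apply: contraNneq c0 => R0; apply/eqP/ffunP => -[[b j] d]; rewrite ffunE.
  have [rt rf] := stepanov_indep (r_size c true) (r_size c false) R0 (ltn_ord j).
  have : r c b j = 0 by case: b.
  move/polyP/(_ d); rewrite coef0 /r coef_sum (bigD1 d) //= coefZ coefXn eqxx mulr1 inord_val.
  by rewrite big1 ?addr0 // => d' d'd; rewrite coefZ coefXn eq_sym (inj_eq val_inj) (negPf d'd) mulr0.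
have R_size : (size R <= J' * p + D + m * h)%N.
  rewrite (leq_trans (size_sum _ _ _)) //; apply/bigmax_leqP => j _.
  rewrite (leq_trans (size_polyMleq _ _)) // size_polyXn addnS /=.
  have jJ : (j * p <= J' * p)%N by rewrite leq_mul2r -ltnS ltn_ord orbT.
  suff : (size (r c true j + r c false j * f ^+ h)%R <= D + m * h)%N.
    by move: jJ; move: (size _) (j * p)%N (J' * p)%N; lia.
  rewrite (leq_trans (size_polyD _ _)) // geq_max (leq_trans (r_size _ _ _)) ?leq_addr //=.
  rewrite (leq_trans (size_polyMleq _ _)) //.
  have := size_poly_exp_leq f h; rewrite size_lin_prod /=; have := r_size c false j.
  by move: (size _) (size _) (m * h)%N; lia.
have : (M * N < size R)%N.
  rewrite /N cardE; apply: size_roots_multiplicity; rewrite ?enum_uniq // => x.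
  rewrite mem_enum inE => /eqP qx.
  have fx0 : f.[x] != 0.
    by apply: contraTneq e1 => fx; rewrite -qx fx qc0.
  apply: (dvdp_XsubC_exp_derivn pF) => [|k kM].
    by rewrite /M; move: J_le T_gt0; rewrite /J; move: m p; clear; nia.
  have : f.[x] ^+ k * R^`(k).[x] = 0.
    rewrite -horner_exp -hornerM /R linear_sum mulr_sumr horner_sum /=.
    transitivity ((Psi c k).[x]); last by rewrite Psi0 // horner0.
    rewrite horner_sum; apply: eq_bigr => j _.
    rewrite derivn_mulXp derivnD mulrA mulrDr stp_derivn !hornerE.
    rewrite exp_half // qx mulnC exprM expf_card; ring.
  by move/eqP; rewrite mulf_eq0 expf_eq0 (negPf fx0) andbF rootE.
move=> MN.
have := card_half F_prime F_gt2.
move: MN R_size D_le; rewrite /M /J; move: (size R) N D m p h; clear; nia.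
Qed.

End Stepanov.

(** * Sets with a prescribed quadratic pattern *)

Section Pattern.
Variable F : finFieldType.
Hypotheses (F_prime : prime #|F|) (F_gt2 : (2 < #|F|)%N).
Local Notation p := #|F|.
Let qcP := qcP F_prime F_gt2.

(** A translation by [c] moves the shifts away from [0]. Stepanov's method bounds from above both
    the number of values [1] and that of values [-1]; since together they make up [p] but for at
    most [m] zeros, the two numbers are close to each other. *)
Lemma char_sum_bound (T : seq F) (J : nat) : uniq T -> (0 < size T)%N -> (0 < J)%N ->
  (12 * J ^ 2 * size T + size T + 2 <= p)%N ->
  (J%:Z * `|\sum_x \prod_(s <- T) qc (x + s)| <= (2 * J * size T)%:Z + (size T * p)%:Z).
Proof.
move=> uT T0 J0 Jp; set m := size T in T0 Jp *.
have [c cT] : exists c : F, - c \notin T.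
  case: (pickP [pred c : F | - c \notin T]) => [c ?|none]; first by exists c.
  have : (p <= m)%N.
    rewrite /m -(size_map -%R) cardE; apply: uniq_leq_size; first exact: enum_uniq.
    move=> x _; have /= /negbFE := none x => xT.
    by apply/mapP; exists (- x); rewrite ?opprK.
  by move: Jp; move: p (m) (J ^ 2)%N; lia.
pose U := [seq c + s | s <- T].
have uU : uniq U by rewrite map_inj_uniq //; exact: addrI.
have sU : size U = m by rewrite size_map.
have U0 : 0 \notin U.
  apply: contra cT => /mapP[s sT E]; suff -> : - c = s by [].
  by apply/eqP; rewrite eq_sym -addr_eq0 addrC -E.
have -> : \sum_x \prod_(s <- T) qc (x + s) = \sum_x qc (lin_prod U).[x].
  rewrite (reindex (fun x => x + c)) /=; last first.
    by apply: onW_bij; apply: injF_bij; apply: addIr.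
  apply: eq_bigr => x _; rewrite horner_lin_prod big_map qc_prod //.
  by apply: eq_bigr => s _; rewrite addrA.
pose D := (p - m)./2.
have D1 : (2 * D + size U <= p)%N.
  by rewrite sU /D; have := odd_double_half (p - m); move: Jp; move: p (m) (J ^ 2)%N; lia.
have D2 : (p <= 2 * D + size U + 1)%N.
  by rewrite sU /D; have := odd_double_half (p - m); move: Jp; move: p (m) (J ^ 2)%N; lia.
have sU0 : (0 < size U)%N by rewrite sU.
have count e e1 := stepanov_count F_prime F_gt2 uU sU0 U0 D1 e1 J0 D2 (e := e).
rewrite sU in count.
have := count 1 isT Jp; have := count (-1) isT Jp.
have N0 : (#|[pred x | qc (lin_prod U).[x] == 0]| <= m)%N.
  rewrite -ltnS -sU -(size_lin_prod U) cardE; apply: max_poly_roots (enum_uniq _).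
    exact: lin_prod_neq0.
  apply/allP => x; rewrite mem_enum inE rootE.
  by case: (qcP (lin_prod U).[x]) => -[Ex -> _]; rewrite ?Ex.
have := card_qc F_prime F_gt2 (fun x => (lin_prod U).[x]).
rewrite sum_qc //; move: N0.
set n0 := #|[pred x | _ == 0]|; set n1 := #|[pred x | _ == 1]|.
set n2 := #|[pred x | _ == -1]|; move: J0; move: (n0) (n1) (n2) (m) p.
clear=> {}n0 {}n1 {}n2 {}m p J0 N0 pE c2 c1.
have [n12|n21] := leqP n1 n2.
  by rewrite distrC ger0_norm ?subr_ge0 ?lez_nat //; nia.
by rewrite ger0_norm ?subr_ge0 ?lez_nat ?(ltnW n21) //; nia.
Qed.

Variables (E : int) (n : nat).
Hypothesis E_bound : forall V : seq F, uniq V -> (0 < size V <= n)%N ->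
  `|\sum_x \prod_(s <- V) qc (x + s)| <= E.

Let E_ge0 : (0 < n)%N -> 0 <= E.
Proof. by move=> n0; apply: le_trans (E_bound (V := [:: 0]) _ _). Qed.

(** Away from the zeros of the [x + s], the first product is [2 ^+ size U] times the indicator of
    [pattern U]. The second one collects the characters already expanded in an induction on [U]. *)
Let G (U V : seq F) : int :=
  \sum_x (\prod_(s <- U) (1 - qc (x + s))) * \prod_(s <- V) qc (x + s).

Let G_cons s U V : G (s :: U) V = G U V - G U (s :: V).
Proof.
by rewrite /G -sumrB; apply: eq_bigr => x _; rewrite !big_cons; ring.
Qed.

(** As [V] is nonempty, the expansion of the first product consists of [2 ^+ size U] nontrivial
    character sums. *)
Lemma pattern_twist U V : uniq (U ++ V) -> (0 < size V)%N -> (size (U ++ V) <= n)%N ->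
  `|G U V| <= 2 ^+ size U * E.
Proof.
elim: U V => [|s U IH] V.
  move=> uV V0 Vn; rewrite expr0 mul1r /G.
  by under eq_bigr do rewrite big_nil mul1r; apply: E_bound; rewrite ?V0.
move=> uUV V0 Vn; rewrite G_cons (le_trans (ler_normB _ _)) //= exprS -mulrA mulr2n mulrDl mul1r.
apply: lerD; apply: IH => //.
- by case/andP: uUV.
- exact: ltnW.
- by have /permPl/perm_uniq -> := perm_catCA U [:: s] V.
- by rewrite size_cat /= addnS -size_cat.
Qed.

Lemma pattern_sum U : uniq U -> (size U <= n)%N ->
  `|G U [::] - p%:Z| <= (2 ^+ size U - 1) * E.
Proof.
elim: U => [|s U IH] uU Un.
  rewrite subrr mul0r /G; under eq_bigr do rewrite !big_nil mulr1.
  by rewrite sumr_const cardT -cardE -[1 *+ _]/(_%:R) natz subrr.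
have /andP[_ uU'] := uU.
have := IH uU' (ltnW Un); have := @pattern_twist U [:: s].
rewrite cats1 rcons_uniq -[_ && _]/(uniq (s :: U)) size_rcons /= => /(_ uU isT Un).
rewrite G_cons exprS; move: (G _ _) (G _ _) (2 ^+ _ : int) => a b c; rewrite !ler_norml; nia.
Qed.

Definition pattern (U : seq F) : {set F} := [set x | all (fun s => qc (x + s) == -1) U].

(** Both bounds come from [pattern_sum]. At the points [x = - s] the product may be positive
    although [x] is not in the pattern set, which costs the term [size U]. *)
Lemma pattern_card U : uniq U -> (0 < size U <= n)%N ->
  2 ^+ size U * (#|pattern U|)%:Z <= p%:Z + 2 ^+ size U * E /\
  p%:Z <= 2 ^+ size U * ((#|pattern U|)%:Z + E + (size U)%:Z).
Proof.
move=> uU /andP[U0 Un]; have := pattern_sum uU Un.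
have E0 : 0 <= E by apply: E_ge0; exact: leq_trans Un.
have pos : 0 <= 2 ^+ size U :> int by exact: exprn_ge0.
have lo : 2 ^+ size U * (#|pattern U|)%:Z <= G U [::].
  rewrite -sum1_card rmorph_sum mulr_sumr big_mkcond /=; apply: ler_sum => x _.
  rewrite big_nil mulr1 mulr1 inE; elim: U {uU Un U0 pos} => [|s U IH] /=.
    by rewrite big_nil expr0.
  rewrite big_cons exprS; case: (qcP (x + s)) => -[_ -> _] //=.
  - rewrite subr0 mul1r; apply: le_trans IH.
    by case: ifP => // _; exact: exprn_ge0.
  - by rewrite subrr mul0r.
  - rewrite opprK; move: IH; move: (2 ^+ size U) (\prod_(_ <- _) _) => a b; case: ifP => _; lia.
have hi : G U [::] <= 2 ^+ size U * ((#|pattern U|)%:Z + (size U)%:Z).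
  have -> : (size U)%:Z = \sum_x \sum_(s <- U) (x + s == 0)%:Z.
    rewrite exchange_big /= -sum1_size rmorph_sum /=; apply: eq_bigr => s _.
    rewrite (bigD1 (- s)) //= addNr eqxx big1 // => x; rewrite addr_eq0 => /negPf -> //.
  rewrite -sum1_card rmorph_sum big_mkcond -big_split mulr_sumr /=; apply: ler_sum => x _.
  rewrite big_nil mulr1 inE; elim: U {uU Un U0 pos lo} => [|s U IH] /=.
    by rewrite !big_nil expr0.
  rewrite !big_cons exprS.
  have S0 : 0 <= \sum_(s <- U) (x + s == 0)%:Z by apply: sumr_ge0.
  have P0 : 0 <= \prod_(s <- U) (1 - qc (x + s)).
    by apply: prodr_ge0 => t _; case: (qcP (x + t)) => -[_ -> _].
  have P2 : \prod_(s <- U) (1 - qc (x + s)) <= 2 ^+ size U.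
    elim: (U) => [|t V IHV]; first by rewrite big_nil expr0.
    rewrite big_cons exprS; apply: ler_pM => //.
    - by case: (qcP (x + t)) => -[_ -> _].
    - by apply: prodr_ge0 => u _; case: (qcP (x + u)) => -[_ -> _].
    - by case: (qcP (x + t)) => -[_ -> _].
  move: IH S0 P0 P2; move: (_ ^+ _) (\prod_(_ <- _) _) (\sum_(_ <- _) _) => a b c.
  by case: (qcP (x + s)) => -[Ex -> _] /=; rewrite ?Ex ?eqxx; case: ifP => _ /=; nia.
move: lo hi; rewrite ler_norml; move: pos E0; move: (size U) p #|pattern U| (G U [::]) (2 ^+ size U).
by move=> a b c d e *; split; nia.
Qed.

End Pattern.

(** * Pairs of primitive elements at a given distance *)

Section Sieve.
Variables (K : realFieldType) (n : nat) (g : nat -> seq nat -> K) (c eps : K).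

Definition sievable (d : nat) (qs : seq nat) :=
  [&& d * \prod_(q <- qs) q %| n & pairwise coprime (d :: qs)]%N.

Hypothesis g_cons : forall d q qs, sievable d (q :: qs) ->
  g d (q :: qs) = g d qs - g (d * q)%N qs.
Hypothesis g_nil : forall d, (d %| n)%N -> `|g d [::] - c / d%:R| <= eps.

Lemma sievable_cons d q qs : sievable d (q :: qs) -> sievable d qs && sievable (d * q) qs.
Proof.
rewrite /sievable /= big_cons mulnA => /and4P[dv /andP[dq dqs] qqs pqs].
rewrite dqs pqs dv !andbT /= (dvdn_trans _ dv) /=; last by rewrite dvdn_mul // dvdn_mulr.
by apply/allP => r rqs; rewrite coprimeMl (allP dqs) // (allP qqs).
Qed.

(** Legendre's sieve: [g d qs] stands for a count with the condition [d] imposed and each [q] of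
    [qs] excluded. Each [q] contributes a factor [1 - 1 / q] to the main term and doubles the
    error. *)
Lemma sieve_bound d qs : sievable d qs ->
  `|g d qs - c / d%:R * \prod_(q <- qs) (1 - q%:R^-1)| <= 2 ^+ size qs * eps.
Proof.
elim: qs d => [|q qs IH] d sd.
  by rewrite big_nil mulr1 expr0 mul1r g_nil //; move: sd; rewrite /sievable big_nil muln1 => /andP[].
rewrite g_cons //; have /andP[s1 s2] := sievable_cons sd.
have := IH _ s1; have := IH _ s2; rewrite big_cons exprS natrM invfM.
set b := g d qs; set a := g (d * q)%N qs; set w := \prod_(_ <- qs) _.
set d' := d%:R^-1; set q' := q%:R^-1 => H1 H2.
have -> : b - a - c * d' * ((1 - q') * w) = (b - c * d' * w) - (a - c * (d' * q') * w) by ring.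
have -> : 2 * 2 ^+ size qs * eps = 2 ^+ size qs * eps + 2 ^+ size qs * eps by ring.
by rewrite (le_trans (ler_normB _ _)) // lerD.
Qed.
End Sieve.

(** * Second moment over pairs of cosets of power residues *)

Section TwoPoint.
Variables (F : finFieldType) (K : realFieldType) (s : K) (t : F).
Hypotheses (s_ge0 : 0 <= s) (s_sq : s ^+ 2 = #|F|%:R) (t0 : t != 0).
Local Notation p := #|F|.
Local Notation n := (#|F|.-1).

Let n_gt0 : (0 < n)%N.
Proof. by rewrite -ltnS prednK ?finNzRing_gt1 // (ltn_trans _ (finNzRing_gt1 _)). Qed.

Lemma expf_card1 (x : F) : x != 0 -> x ^+ n = 1.
Proof.
move=> x0; apply: (mulfI x0); rewrite -exprS prednK ?mulr1 ?expf_card //.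
exact: ltn_trans (finNzRing_gt1 _).
Qed.

Lemma card_unity_roots k : (0 < k)%N -> (#|[set x : F | x ^+ k == 1%R]| <= k)%N.
Proof.
move=> k0; rewrite -ltnS cardE -(size_XnsubC (1 : F) k0).
apply: max_poly_roots (enum_uniq _); first by rewrite -size_poly_gt0 size_XnsubC.
by apply/allP => x; rewrite mem_enum inE rootE !hornerE subr_eq0.
Qed.

(** For [k = n / d] and [l = n / e], the conditions place [x] in a coset of the [d]-th powers and
    [x + t] in a coset of the [e]-th powers. *)
Definition cell (k l : nat) (z w : F) : {set F} :=
  [set x | [&& x != 0, x + t != 0, x ^+ k == z & (x + t) ^+ l == w]].

(* Off the diagonal, [(x, y) |-> (x / y, (x + t) / (y + t))] is injective. *)
Lemma cell_square_sum k l : (0 < k)%N -> (0 < l)%N ->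
  (\sum_z \sum_w #|cell k l z w| ^ 2 <= p + k * l)%N.
Proof.
move=> k0 l0.
pose X := [set x : F | (x != 0) && (x + t != 0)].
pose Q := [set xy : F * F | [&& xy.1 \in X, xy.2 \in X, xy.1 ^+ k == xy.2 ^+ k &
   (xy.1 + t) ^+ l == (xy.2 + t) ^+ l]].
have -> : (\sum_z \sum_w #|cell k l z w| ^ 2 = #|Q|)%N.
  have E z w : (#|cell k l z w| ^ 2 =
      \sum_(xy in Q) (xy.1 \in cell k l z w))%N.
    rewrite -mulnn -cardsX -sum1_card big_mkcond [RHS]big_mkcond /=.
    apply: eq_bigr => -[x y] _; rewrite !inE /=.
    have [xz|] := eqVneq (x ^+ k) z; last by rewrite !andbF if_same.
    have [xw|] := eqVneq ((x + t) ^+ l) w; last by rewrite !andbF if_same.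
    rewrite !andbT xz xw [z == _]eq_sym [w == _]eq_sym.
    by case: (x != 0); case: (x + t != 0); rewrite /= ?if_same // -!andbA; case: ifP.
  under eq_bigr do under eq_bigr do rewrite E.
  under eq_bigr do rewrite exchange_big /=.
  rewrite exchange_big /= -sum1_card; apply: eq_bigr => -[x y]; rewrite inE /= => /and3P[xX _ _].
  rewrite (bigD1 (x ^+ k)) //= (bigD1 ((x + t) ^+ l)) //= !inE !eqxx !andbT.
  move: xX; rewrite inE => -> /=.
  rewrite big1 => [|w wl]; last by rewrite inE [_ == w]eq_sym (negPf wl) !andbF.
  rewrite big1 // => z zk; rewrite big1 // => w _.
  by rewrite inE [_ == z]eq_sym (negPf zk) !andbF.
rewrite -(cardsID [set xy | xy.1 == xy.2] Q); apply: leq_add.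
  have -> : p = #|[set (x, x) | x : F]| by rewrite card_imset ?cardsT // => x y [].
  apply/subset_leq_card/subsetP => -[x y]; rewrite !inE /= => /andP[_ /eqP <-].
  exact: imset_f.
pose phi (xy : F * F) := (xy.1 / xy.2, (xy.1 + t) / (xy.2 + t)).
rewrite -(card_in_imset (f := phi)).
  rewrite (leq_trans (subset_leq_card
    (_ : _ \subset setX [set v : F | v ^+ k == 1] [set v | v ^+ l == 1]))) //.
    apply/subsetP => _ /imsetP[[x y] + ->]; rewrite !inE /=.
    move=> /andP[_ /and4P[/andP[x0 xt] /andP[y0 yt] /eqP xy /eqP xyt]].
    by rewrite !exprMn !exprVn xy xyt !divff ?expf_neq0 ?eqxx.
  by rewrite cardsX leq_mul // card_unity_roots.
move=> [x y] [x' y']; rewrite !inE /=.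
move=> /andP[xy /and4P[/andP[x0 xt] /andP[y0 yt] _ _]].
move=> /andP[xy' /and4P[/andP[x0' xt'] /andP[y0' yt'] _ _]] [Ev Ew].
pose v := x / y; pose w := (x + t) / (y + t).
have xE : x = v * y by rewrite /v mulfVK.
have xE' : x' = v * y' by rewrite /v Ev mulfVK.
have wE : v * y + t = w * (y + t) by rewrite -xE /w mulfVK.
have wE' : v * y' + t = w * (y' + t) by rewrite -xE' /w Ew mulfVK.
(* If [v = w], then [t (w - 1) = 0], so [x = y], which is excluded off the diagonal. Otherwise
   [(v - w) y = (w - 1) t] determines [y]. *)
have vw : v - w != 0.
  apply: contra xy; rewrite subr_eq0 => /eqP vw; apply/eqP.
  have : t * (w - 1) = 0 by move: wE; rewrite vw mulrDr => /addrI E; rewrite mulrBr mulr1 mulrC -E subrr.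
  by move/eqP; rewrite mulf_eq0 (negPf t0) subr_eq0 => /eqP w1; rewrite xE vw w1 mul1r.
have yE : (v - w) * y = (v - w) * y'.
  have -> : (v - w) * y = w * t - t by rewrite mulrBl; apply/eqP; rewrite subr_eq addrAC -subr_eq opprK wE; apply/eqP; ring.
  by rewrite mulrBl; apply/eqP; rewrite eq_sym subr_eq addrAC -subr_eq opprK wE'; apply/eqP; ring.
by have /= yy := mulfI vw yE; rewrite xE xE' yy.
Qed.

Let units_pair := [set x : F | (x != 0) && (x + t != 0)].

Lemma card_units_pair : (#|units_pair| + 2 = p)%N.
Proof.
rewrite -(cardsC units_pair) (_ : ~: units_pair = [set 0; - t]).
  by rewrite cards2 eq_sym oppr_eq0 t0.
by apply/setP => x; rewrite !inE negb_and !negbK addr_eq0.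
Qed.

Lemma cell_sum d e : (d %| n)%N -> (e %| n)%N ->
  (\sum_(z | z ^+ d == 1%R) \sum_(w | w ^+ e == 1%R) #|cell (n %/ d) (n %/ e) z w|
    = #|units_pair|)%N.
Proof.
move=> dn en.
have E z w : (#|cell (n %/ d) (n %/ e) z w| =
    \sum_(x in units_pair) ((x ^+ (n %/ d) == z) && ((x + t) ^+ (n %/ e) == w)))%N.
  rewrite -sum1_card big_mkcond [RHS]big_mkcond /=; apply: eq_bigr => x _.
  by rewrite !inE; do 4!case: (_ == _).
under eq_bigr do under eq_bigr do rewrite E.
under eq_bigr do rewrite exchange_big /=.
rewrite exchange_big /= -[RHS]sum1_card; apply: eq_bigr => x; rewrite inE => /andP[x0 xt0].
rewrite (bigD1 (x ^+ (n %/ d))) /=; last by rewrite -exprM divnK // expf_card1.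
rewrite (bigD1 ((x + t) ^+ (n %/ e))) /=; last by rewrite -exprM divnK // expf_card1.
rewrite !eqxx big1 => [|w /andP[_ we]]; last by rewrite [_ == w]eq_sym (negPf we) andbF.
rewrite big1 // => z /andP[_ zd]; rewrite big1 // => w _.
by rewrite [_ == z]eq_sym (negPf zd).
Qed.

(** The cells with [z ^+ d = 1] and [w ^+ e = 1] have total size [p - 2] and sum of squares at most
    [p + n^2 / (d e)]. The sum of their squared deviations from [c] is therefore at most [4 p], and
    so is each single one. *)
Lemma cell_bound d e z w : (d %| n)%N -> (e %| n)%N -> z ^+ d = 1 -> w ^+ e = 1 ->
  `|(#|cell (n %/ d) (n %/ e) z w|)%:R - (p%:R - 2) / (d%:R * e%:R)| <= 2 * s.
Proof.
move=> dn en zd we.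
have d0 : (0 < d)%N by exact: dvdn_gt0 dn.
have e0 : (0 < e)%N by exact: dvdn_gt0 en.
set N := fun z w => (#|cell (n %/ d) (n %/ e) z w|)%:R : K.
set c := (p%:R - 2) / (d%:R * e%:R).
have pE : p%:R = n%:R + 1 :> K by rewrite natr1 prednK // (ltn_trans _ (finNzRing_gt1 _)).
have N1 : \sum_(z | z ^+ d == 1) \sum_(w | w ^+ e == 1) N z w = p%:R - 2.
  rewrite -card_units_pair natrD addrK -(cell_sum dn en) natr_sum.
  by apply: eq_bigr => ? _; rewrite natr_sum.
have N2 : \sum_(z | z ^+ d == 1) \sum_(w | w ^+ e == 1) N z w ^+ 2
    <= p%:R + n%:R ^+ 2 / (d%:R * e%:R).
  have nd : (0 < n %/ d)%N by rewrite divn_gt0 // dvdn_leq.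
  have ne : (0 < n %/ e)%N by rewrite divn_gt0 // dvdn_leq.
  have := cell_square_sum nd ne.
  rewrite -(ler_nat K) natrD natrM !natf_div // => /(le_trans _).
  have -> : n%:R ^+ 2 / (d%:R * e%:R) = n%:R / d%:R * (n%:R / e%:R) :> K.
    by field; rewrite !pnatr_eq0 -!lt0n d0 e0.
  apply; rewrite natr_sum big_mkcond; apply: ler_sum => u _.
  rewrite natr_sum; case: ifP => _; last by apply: sumr_ge0 => v _; exact: ler0n.
  rewrite big_mkcond; apply: ler_sum => v _.
  by rewrite natrX; case: ifP => _; rewrite ?exprn_ge0.
have card_le k : (0 < k)%N -> (#|[pred z : F | z ^+ k == 1]|%:R <= k%:R :> K).
  move=> k0; rewrite ler_nat; apply: leq_trans (card_unity_roots k0).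
  by rewrite cardsE.
have N0 : \sum_(z : F | z ^+ d == 1) \sum_(w : F | w ^+ e == 1) c ^+ 2 <= d%:R * e%:R * c ^+ 2.
  rewrite !sumr_const -mulrnA -[leLHS]mulr_natl natrM mulrC [leRHS]mulrC ler_wpM2l ?sqr_ge0 //.
  by rewrite mulrC ler_pM ?ler0n // card_le.
have de0 : 0 < d%:R * e%:R :> K by rewrite mulr_gt0 ?ltr0n.
have de1 : 1 <= d%:R * e%:R :> K by rewrite -natrM ler1n muln_gt0 d0.
have S : (N z w - c) ^+ 2 <= \sum_(z | z ^+ d == 1) \sum_(w | w ^+ e == 1) (N z w - c) ^+ 2.
  rewrite (bigD1 z) ?zd ?eqxx //= (bigD1 w) ?we ?eqxx //= -addrA lerDl.
  by apply: addr_ge0; apply: sumr_ge0 => v _; rewrite ?sqr_ge0 ?sumr_ge0 // => ? _; rewrite sqr_ge0.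
have SE : \sum_(z | z ^+ d == 1) \sum_(w | w ^+ e == 1) (N z w - c) ^+ 2 =
   \sum_(z | z ^+ d == 1) \sum_(w | w ^+ e == 1) N z w ^+ 2
   - 2 * c * (\sum_(z | z ^+ d == 1) \sum_(w | w ^+ e == 1) N z w)
   + \sum_(z : F | z ^+ d == 1) \sum_(w : F | w ^+ e == 1) c ^+ 2.
  rewrite mulr_sumr -sumrB -big_split; apply: eq_bigr => u _ /=.
  rewrite mulr_sumr -sumrB -big_split; apply: eq_bigr => v _ /=; ring.
have cE : d%:R * e%:R * c = p%:R - 2 by rewrite /c mulrC divfK // gt_eqF.
have n2 : n%:R ^+ 2 = d%:R * e%:R * (n%:R ^+ 2 / (d%:R * e%:R)) :> K.
  by rewrite mulrC divfK // gt_eqF.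
have n1 : 1 <= n%:R :> K by rewrite ler1n.
have fin : (N z w - c) ^+ 2 <= (2 * s) ^+ 2.
  have -> : (2 * s) ^+ 2 = 4 * p%:R by rewrite exprMn s_sq; ring.
  apply: le_trans S _; rewrite SE N1 -cE.
  move: N2 N0 n2 cE; set A := n%:R ^+ 2 / _; set D := d%:R * e%:R in de0 de1 *.
  move: (\sum_(_ | _) _) (\sum_(_ | _) _) => S0 S2 N2 N0 n2 cE.
  have : D * A - D * (D * c ^+ 2) <= D * (2 * p%:R).
    have -> : D * (D * c ^+ 2) = (D * c) ^+ 2 by ring.
    by rewrite -n2 cE pE; nra.
  rewrite -mulrBr ler_pM2l // => AD.
  nra.
by rewrite -(ler_pXn2r (n := 2)) ?nnegrE ?normr_ge0 ?mulr_ge0 // real_normK ?num_real.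
Qed.

(** For divisors of [n], this says that [x] is a nonzero [d]-th power and a [q]-th power for no [q]
    in [qs]. *)
Definition sift (d : nat) (qs : seq nat) (x : F) : bool :=
  (x ^+ (n %/ d) == 1) && all (fun q => x ^+ (n %/ q) != 1) qs.

Lemma expf_divn_coprime (x : F) d q : coprime d q -> (d * q %| n)%N ->
  (x ^+ (n %/ (d * q)) == 1) = (x ^+ (n %/ d) == 1) && (x ^+ (n %/ q) == 1).
Proof.
move=> dq dqn.
have d0 : (0 < d)%N by have := dvdn_gt0 n_gt0 dqn; rewrite muln_gt0 => /andP[].
have q0 : (0 < q)%N by have := dvdn_gt0 n_gt0 dqn; rewrite muln_gt0 => /andP[].
have nE := divnK dqn; set k := (n %/ (d * q))%N in nE *.
rewrite -{1}nE -{1}nE -/k.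
have -> : ((k * (d * q)) %/ d = k * q)%N by rewrite mulnCA mulKn.
have -> : ((k * (d * q)) %/ q = k * d)%N by rewrite mulnA mulnK.
rewrite !exprM; set y := x ^+ k.
apply/eqP/andP => [->|[/eqP yq /eqP yd]]; first by rewrite !expr1n eqxx.
have /coprimeP := dq => /(_ d0) [[u v] /= uv].
have E : (u * d = 1 + v * q)%N by move: uv; lia.
have : y ^+ (u * d) = 1 by rewrite mulnC exprM yd expr1n.
by rewrite E exprD expr1 mulnC exprM yq expr1n mulr1.
Qed.

Lemma sift_cons d q qs x : sievable n d (q :: qs) ->
  (sift d (q :: qs) x)%:R = (sift d qs x)%:R - (sift (d * q) qs x)%:R :> K.
Proof.
rewrite /sievable /= big_cons mulnA => /andP[dv /andP[/andP[dq _] _]].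
have dqn : (d * q %| n)%N by apply: dvdn_trans dv; exact: dvdn_mulr.
rewrite /sift expf_divn_coprime //=.
by case: (_ == 1); case: (_ == 1); case: (all _ _); rewrite /= ?subr0 ?subrr ?sub0r.
Qed.

(** The sieve is applied twice: first to the conditions on [x + t] for a fixed [d], with
    [cell_bound] as input, then to those on [x]. *)
Lemma two_point_sieve qs rs : sievable n 1 qs -> sievable n 1 rs ->
  `|\sum_x (sift 1 qs x)%:R * (sift 1 rs (x + t))%:R
    - (p%:R - 2) * (\prod_(r <- rs) (1 - r%:R^-1)) * \prod_(q <- qs) (1 - q%:R^-1)|
  <= 2 ^+ size qs * (2 ^+ size rs * (2 * s)).
Proof.
move=> sq sr.
have inner d : (d %| n)%N -> `|\sum_x (sift d [::] x)%:R * (sift 1 rs (x + t))%:R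
    - (p%:R - 2) / d%:R * \prod_(r <- rs) (1 - r%:R^-1)| <= 2 ^+ size rs * (2 * s).
  move=> dn; have := @sieve_bound K n (fun e rs => \sum_x (sift d [::] x)%:R *
    (sift e rs (x + t))%:R) ((p%:R - 2) / d%:R) (2 * s) _ _ 1%N rs sr.
  rewrite divr1; apply=> [e r rs' s'|e en].
    by rewrite -sumrB; apply: eq_bigr => x _; rewrite (sift_cons _ s') mulrBr.
  have -> : \sum_x (sift d [::] x)%:R * (sift e [::] (x + t))%:R =
      (#|cell (n %/ d) (n %/ e) 1 1|)%:R :> K.
    rewrite -[#|cell _ _ _ _|]sum1_card natr_sum [RHS]big_mkcond /=; apply: eq_bigr => x _.
    have pos k y : (k %| n)%N -> y ^+ (n %/ k) == 1 -> y != 0 :> F.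
      move=> kn; apply: contraTneq => ->; rewrite expr0n eqn0Ngt.
      by rewrite divn_gt0 ?(dvdn_gt0 _ kn) // dvdn_leq //= eq_sym oner_eq0.
    rewrite inE /sift /= !andbT.
    have [x1|x1] := boolP (x ^+ (n %/ d) == 1); last by rewrite !andbF mul0r.
    have [y1|y1] := boolP ((x + t) ^+ (n %/ e) == 1); last by rewrite !andbF mulr0.
    by rewrite (pos _ _ dn x1) (pos _ _ en y1) mulr1.
  by have := cell_bound dn en (expr1n _ _) (expr1n _ _); rewrite invfM mulrA.
have := @sieve_bound K n (fun d qs => \sum_x (sift d qs x)%:R * (sift 1 rs (x + t))%:R)
  ((p%:R - 2) * \prod_(r <- rs) (1 - r%:R^-1)) (2 ^+ size rs * (2 * s)) _ _ 1%N qs sq.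
rewrite divr1; apply=> [d q qs' s'|d dn].
  by rewrite -sumrB; apply: eq_bigr => x _; rewrite (sift_cons _ s') mulrBl.
by rewrite mulrAC; exact: inner.
Qed.

Lemma primes_sievable : sievable n 1 (primes n).
Proof.
rewrite /sievable mul1n /=; apply/and3P; split.
- rewrite {2}(prod_prime_decomp n_gt0) prime_decompE big_map /= !big_seq.
  apply: (big_ind2 (fun a b => a %| b)%N) => [|a b c d ab cd|q qn]; rewrite ?dvdn_mul //.
  by rewrite dvdn_exp // logn_gt0.
- by apply/allP => q _; rewrite coprime1n.
have := primes_uniq n; rewrite uniq_pairwise; apply: (@sub_in_pairwise _ prime).
  by move=> q r q_pr r_pr /= qr; rewrite prime_coprime // dvdn_prime2.
by apply/allP => q; rewrite mem_primes => /and3P[].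
Qed.

Lemma sift_primitive x : n.-primitive_root x -> sift 1 (primes n) x.
Proof.
move=> xn; rewrite /sift divn1 prim_expr_order // eqxx; apply/allP => q.
rewrite mem_primes => /and3P[q_pr _ qn]; rewrite -(prim_order_dvd xn).
have nq : (0 < n %/ q)%N by rewrite divn_gt0 ?prime_gt0 // dvdn_leq.
by rewrite gtnNdvd // ltn_Pdiv // prime_gt1.
Qed.

Lemma two_point_primitive :
  (#|[set x | n.-primitive_root x && n.-primitive_root (x + t)]|)%:R <=
   (p%:R - 2) * (\prod_(q <- primes n) (1 - q%:R^-1)) ^+ 2
   + 2 ^+ size (primes n) * (2 ^+ size (primes n) * (2 * s)) :> K.
Proof.
have := two_point_sieve primes_sievable primes_sievable.
rewrite ler_distl => /andP[_ H]; rewrite [_ ^+ 2]expr2 [_ * (_ * \prod_(_ <- _) _)]mulrA.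
apply: le_trans H.
rewrite -sum1_card natr_sum big_mkcond /=; apply: ler_sum => x _; rewrite inE.
case: andP => [[x1 x2]|_]; first by rewrite !sift_primitive ?mulr1.
by rewrite mulr_ge0.
Qed.

End TwoPoint.

(** * Euler's totient and the number of prime factors *)

Lemma totient_prod (K : realFieldType) n : (0 < n)%N ->
  (totient n)%:R = n%:R * \prod_(q <- primes n) (1 - q%:R^-1) :> K.
Proof.
move=> n0; have nE : n%:R = \prod_(q <- primes n) (q ^ logn q n)%:R :> K.
  by rewrite {1}(prod_prime_decomp n0) prime_decompE big_map natr_prod.
rewrite totientE // nE natr_prod -big_split /=.
rewrite !big_seq; apply: eq_bigr => q qn.
have : prime q by move: qn; rewrite mem_primes => /and3P[].
case: q qn => // q qn q_pr; have := qn; rewrite -logn_gt0; case: (logn _ _) => // l _ /=.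
rewrite natrM expnS natrM mulrAC; congr (_ * _).
by rewrite mulrBr mulr1 divff ?pnatr_eq0 // -natr1 addrK.
Qed.

(* The primes below [2 ^ b] are few, and each other prime factor is at least [2 ^ b]. *)
Lemma two_exp_primes (b n : nat) : (0 < n)%N ->
  ((2 ^ b) ^ size (primes n) <= (2 ^ b) ^ (2 ^ b) * n)%N.
Proof.
move=> n0; set c := (2 ^ b)%N; have c0 : (0 < c)%N by rewrite expn_gt0.
rewrite -(count_predC (fun q => q < c)%N) expnD; apply: leq_mul.
  rewrite leq_pexp2l // -size_filter -[c in (_ <= c)%N](size_iota 0).
  apply: uniq_leq_size; first by rewrite filter_uniq // primes_uniq.
  by move=> q; rewrite mem_filter mem_iota => /andP[].
rewrite [X in (_ <= X)%N](prod_prime_decomp n0) prime_decompE big_map /=.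
have : all (fun q => (prime q) && (0 < logn q n)%N) (primes n).
  by apply/allP => q qn; rewrite logn_gt0 qn; move: qn; rewrite mem_primes => /and3P[->].
elim: (primes n) => [|q r IH] /=; first by rewrite big_nil.
rewrite big_cons => /andP[/andP[q_pr l0] /IH{}IH]; rewrite expnD.
apply: leq_mul IH; rewrite -leqNgt; case: (leqP c q) => [cq|_] /=.
  by rewrite expn1 (leq_trans cq) // -[X in (X <= _)%N]expn1 leq_pexp2l // prime_gt0.
by rewrite expn0 expn_gt0 prime_gt0.
Qed.

(** * Additive decompositions of the primitive elements *)

Lemma sqrtn_ex (N : nat) : exists r, (r ^ 2 <= N < r.+1 ^ 2)%N.
Proof.
elim: N => [|N [r /andP[r1 r2]]]; first by exists 0%N.
have [lt|ge] := ltnP N.+1 (r.+1 ^ 2)%N; first by exists r; rewrite lt (leq_trans r1).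
by exists r.+1; move: r1 r2 ge; nia.
Qed.

Section Decomposition.
Variable F : finFieldType.
Hypotheses (F_prime : prime #|F|) (F_gt2 : (2 < #|F|)%N).
Local Notation p := #|F|.
Local Notation n := (#|F|.-1).
Local Notation P := [set x : F | n.-primitive_root x].
Variables (A B : {set F}).
Hypotheses (sumAB : [set a + b | a in A, b in B] = P).
Hypotheses (A_gt0 : (0 < #|A|)%N) (B_gt1 : (1 < #|B|)%N).

Lemma sum_primitive a b : a \in A -> b \in B -> n.-primitive_root (a + b).
Proof. by move=> aA bB; have := imset2_f +%R aA bB; rewrite sumAB inE. Qed.

Lemma qc_primitive (x : F) : n.-primitive_root x -> qc x = -1.
Proof.
move=> xn; case: (qcP F_prime F_gt2 x) => -[x0 qx hx] //.
  have := prim_expr_order xn; rewrite x0 expr0n eqn0Ngt (prim_order_gt0 xn) => /esym/eqP.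
  by rewrite oner_eq0.
have := prim_order_dvd xn (#|F|./2); rewrite hx eqxx => /dvdn_leq.
by move: (card_half F_prime F_gt2) F_gt2; move: (_./2) => h -> /=; lia.
Qed.

Lemma card_primitive : (totient n <= #|P|)%N.
Proof.
have [a aA] := card_gt0P A_gt0; have [b bB] := card_gt0P (ltnW B_gt1).
have zn := sum_primitive aA bB; set z := a + b in zn.
have -> : totient n = #|[set i : 'I_n | coprime n i]|.
  rewrite totient_count_coprime big_mkord -[RHS]sum1_card [RHS]big_mkcond.
  by apply: eq_bigr => i _; rewrite inE; case: coprime.
rewrite -(card_in_imset (f := fun i : 'I_n => z ^+ i)).
  apply/subset_leq_card/subsetP => _ /imsetP[i + ->].
  by rewrite !inE prim_root_exp_coprime // coprime_sym.
move=> i j _ _ /= /eqP; rewrite (eq_prim_root_expr zn) !modn_small // => /eqP.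
exact: val_inj.
Qed.

Lemma card_product : (totient n <= #|A| * #|B|)%N.
Proof.
rewrite (leq_trans card_primitive) // -sumAB -cardsX.
apply: leq_trans (leq_imset_card (fun ab => ab.1 + ab.2) _).
apply/subset_leq_card/subsetP => _ /imset2P[a b aA bB ->].
by apply/imsetP; exists (a, b); rewrite ?inE ?aA.
Qed.

(** Each [a] in [A] contributes [#|B| ^ 4] to the fourth moment, because all [a + b] are
    non-residues. The integer square root [r] of [4 p + 1] bounds the quartic sums. *)
Lemma fourth_moment_card : exists2 r : nat, (r ^ 2 <= 4 * p + 1)%N &
  (#|A| * #|B| ^ 2 <= 3 * p + #|B| ^ 2 * r)%N.
Proof.
have [r /andP[r1 r2]] := sqrtn_ex (4 * p + 1); exists r => //.
have HM (b1 b2 b3 b4 : F) : uniq [:: b1; b2; b3; b4] ->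
    \sum_x qc ((x + b1) * (x + b2) * (x + b3) * (x + b4)) <= r%:Z.
  move=> u.
  have [//|Qr] := lerP (\sum_x qc ((x + b1) * (x + b2) * (x + b3) * (x + b4))) r%:Z.
  have := quartic_bound F_prime F_gt2 u erefl.
  move: Qr; set Q := \sum_x _; move: r2 => {r1}; move: p => q; nia.
have := fourth_moment F_prime F_gt2 B (M := r%:Z) isT HM.
have lo : (#|A| * #|B| ^ 4)%N%:Z <= \sum_x (\sum_(b in B) qc (x + b)) ^+ 4.
  rewrite (bigID (mem A)) /= -[leLHS]addr0 lerD //; last first.
    by apply: sumr_ge0 => x _; rewrite (exprM _ 2 2) sqr_ge0.
  rewrite (eq_bigr (fun=> (#|B| ^ 4)%N%:Z)) => [|a aA].
    by rewrite sumr_const -mulr_natl natz -PoszM.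
  rewrite (eq_bigr (fun=> -1)) => [|b bB]; last exact: qc_primitive (sum_primitive aA bB).
  by rewrite sumr_const -mulr_natl natz mulrN1 -[RHS]natz natrX natz; ring.
move/(le_trans lo); move: #|A| #|B| B_gt1 p => a k k1 q; nia.
Qed.

(** For distinct [b1] and [b2] in [B], the elements of [A + b2] are primitive and remain so after
    adding [b1 - b2]. *)
Lemma two_point_card (K : realFieldType) (s : K) : 0 <= s -> s ^+ 2 = p%:R ->
  (#|A|)%:R <= (p%:R - 2) * (\prod_(q <- primes n) (1 - q%:R^-1)) ^+ 2
   + 2 ^+ size (primes n) * (2 ^+ size (primes n) * (2 * s)).
Proof.
move=> s0 s2; have [b1 [b2 [b1B b2B b12]]] := card_gt1P B_gt1.
apply: le_trans (two_point_primitive s0 s2 (t := b1 - b2) _); last by rewrite subr_eq0.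
rewrite ler_nat -(card_imset _ (addIr b2)); apply/subset_leq_card/subsetP => _ /imsetP[a aA ->].
rewrite inE; have -> : a + b2 + (b1 - b2) = a + b1 by ring.
by rewrite !sum_primitive.
Qed.

Lemma sub_pattern U : {subset U <= B} -> A \subset pattern U.
Proof.
move=> UB; apply/subsetP => a aA; rewrite inE; apply/allP => b /UB bB.
by rewrite qc_primitive // sum_primitive.
Qed.

Variables (E : int) (m : nat).
Hypothesis E_bound : forall V : seq F, uniq V -> (0 < size V <= m)%N ->
  `|\sum_x \prod_(s <- V) qc (x + s)| <= E.

(* [P] is covered by the translates of the pattern set [W] of [B], and each of these meets
   a fixed one of them in a pattern set of at most [L] points. *)
Lemma cover_bound (k := #|B|) (L := (2 * k - 1)%N) : (L <= m)%N ->
  2 ^+ L * (totient n)%:Z + (k%:Z - 1) * p%:Z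
    <= k%:Z * 2 ^+ k.-1 * (p%:Z + 2 ^+ k * E) + (k%:Z - 1) * 2 ^+ L * (E + L%:Z).
Proof.
move=> Lm; set W := pattern (enum B).
have km : (0 < size (enum B) <= m)%N.
  by rewrite -cardE; move: Lm B_gt1; rewrite /L /k; move: #|B|; lia.
have [W_le _] := pattern_card F_prime F_gt2 E_bound (enum_uniq B) km.
rewrite -cardE -/W -/k in W_le.
have [b1 b1B] := card_gt0P (ltnW B_gt1).
pose Wt b := [set x | x - b \in W].
have Wt_card b : #|Wt b| = #|W|.
  rewrite -(card_imset W (addIr b)); apply: eq_card => x.
  rewrite inE; apply/idP/imsetP => [xW|[w wW ->]]; last by rewrite addrK.
  by exists (x - b); rewrite ?subrK.
have overlap b : b \in B -> p%:Z - 2 ^+ L * (E + L%:Z) <= 2 ^+ L * (#|Wt b :&: Wt b1|)%:Z.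
  move=> bB.
  (* Both [B - b] and [B - b1] contain [0], so omitting [b1] from the second list loses no shift and
     leaves at most [L = 2 k - 1] of them. *)
  pose U := undup ([seq s - b | s <- enum B] ++ [seq s - b1 | s <- enum (B :\ b1)]).
  have sU : (size U <= L)%N.
    rewrite (leq_trans (size_undup _)) // size_cat !size_map -!cardE.
    by move: (cardsD1 b1 B) B_gt1; rewrite b1B /L /k; move: #|B| #|B :\ b1|; lia.
  have U0 : (0 < size U <= m)%N.
    rewrite (leq_trans sU Lm) andbT -has_predT; apply/hasP; exists (b - b) => //.
    rewrite mem_undup mem_cat; apply/orP; left.
    by apply/mapP; exists b; rewrite ?mem_enum.
  have [_] := pattern_card F_prime F_gt2 E_bound (undup_uniq _) U0.
  have -> : pattern U = Wt b :&: Wt b1.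
    have in_Wt c x : x \in Wt c -> forall s, s \in B -> qc (x + (s - c)) = -1.
      rewrite !inE => /allP xc s sB; have := xc s; rewrite mem_enum => /(_ sB) /eqP <-.
      by congr qc; ring.
    apply/setP => x; apply/idP/idP => [|/setIP[xb xb1]]; last first.
      rewrite inE; apply/allP => u; rewrite mem_undup mem_cat.
      case/orP => /mapP[s]; rewrite mem_enum => sB ->; first by rewrite (in_Wt b).
      by rewrite (in_Wt b1) //; case/setD1P: sB.
    rewrite inE all_undup all_cat !all_map => /andP[/allP xb /allP xb1].
    have xb' s : s \in B -> qc (x - b + s) == -1.
      by move=> sB; have := xb s; rewrite mem_enum /= addrA addrAC => /(_ sB).
    apply/setIP; split; rewrite !inE; apply/allP => s; rewrite mem_enum => sB; first exact: xb'.
    have [->|sb1] := eqVneq s b1.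
      by rewrite subrK; have := xb' _ bB; rewrite subrK.
    have := xb1 s; rewrite mem_enum in_setD1 sb1 /= addrA addrAC; exact.
  have : 2 ^+ size U <= 2 ^+ L :> int by rewrite ler_eXn2l.
  have : (size U)%:Z <= L%:Z by rewrite lez_nat.
  have : 0 <= E by apply: le_trans (E_bound (V := [:: 0]) _ _) => //; move: km => /andP[/leq_trans]; apply.
  have : 0 <= 2 ^+ size U :> int by exact: exprn_ge0.
  set w := #|_ :&: _|; move: (size U) (2 ^+ size U) (2 ^+ L) p => q d c r; nia.
have cover : (#|P| <= #|Wt b1| + \sum_(b in B :\ b1) #|Wt b :\: Wt b1|)%N.
  have E1 (S : {set F}) : #|S| = (\sum_x (x \in S))%N.
    by rewrite -sum1_card big_mkcond.
  rewrite !E1; under [X in (_ <= _ + X)%N]eq_bigr do rewrite E1.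
  rewrite exchange_big -big_split /=; apply: leq_sum => x _.
  have [xP|//] := boolP (x \in P).
  have := xP; rewrite -sumAB => /imset2P[a b aA bB xE].
  have xb : x \in Wt b.
    rewrite inE xE addrK; apply: (subsetP (sub_pattern _)) aA => c.
    by rewrite mem_enum.
  have [//|xb1] := boolP (x \in Wt b1); rewrite add0n.
  have bb1 : b \in B :\ b1 by rewrite !inE bB andbT; apply: contra xb1 => /eqP <-.
  by rewrite (bigD1 b) //= inE xb1 xb.
have {}cover : 2 ^+ L * (totient n)%:Z <= 2 ^+ L * (#|W|)%:Z
    + \sum_(b in B :\ b1) (2 ^+ L * (#|W|)%:Z - (p%:Z - 2 ^+ L * (E + L%:Z))).
  have : 2 ^+ L * (totient n)%:Z <= 2 ^+ L * (#|Wt b1|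
      + \sum_(b in B :\ b1) #|Wt b :\: Wt b1|)%N%:Z.
    by rewrite ler_wpM2l ?exprn_ge0 // lez_nat (leq_trans card_primitive).
  move/le_trans; apply; rewrite PoszD Wt_card mulrDr lerD2l.
  rewrite -[(\sum_(_ in _) _)%N%:Z]natz natr_sum mulr_sumr; apply: ler_sum => b /setD1P[_ bB].
  have := overlap b bB; have := cardsID (Wt b1) (Wt b); rewrite Wt_card => <-.
  rewrite natz PoszD; move: #|_| #|_| (2 ^+ L) p => x y z q; lia.
rewrite sumr_const -[X in _ <= _ + X]mulr_natl [#|B :\ b1|%:R]natz in cover.
have kE : (#|B :\ b1|)%:Z = k%:Z - 1 by rewrite /k (cardsD1 b1 B) b1B add1n intS; ring.
have LE : 2 ^+ L = 2 ^+ k.-1 * 2 ^+ k :> int.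
  by rewrite -exprD; congr (_ ^+ _); move: B_gt1; rewrite /L /k; move: #|B|; lia.
move: cover W_le; rewrite kE LE.
have : 0 <= 2 ^+ k.-1 :> int by exact: exprn_ge0.
move: #|W| (2 ^+ k.-1) (2 ^+ k) (L%:Z) (totient n) p => w x y l tot q x0 cover W_le.
have : k%:Z * x * (y * w%:Z) <= k%:Z * x * (q%:Z + y * E) by rewrite ler_wpM2l ?mulr_ge0.
by move: cover; nia.
Qed.

End Decomposition.

(** * Numerical consequences *)

Section Numeric.
Variables (K : realFieldType) (eps u a k rho C E : K).
Hypotheses (eps_gt0 : 0 < eps) (eps_lt : eps < 1 / 2) (u_ge1 : 1 <= u).
Hypotheses (a_ge0 : 0 <= a) (k_ge1 : 1 <= k) (C_ge0 : 0 <= C).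

(** Here [u] stands for [p^(1/16)], [a] and [k] for the sizes of [A] and [B]. For such large [k] the
    term [3 p / k^2] is at most [eps * u ^+ 8]. *)
Lemma fourth_moment_large r : r <= 2 * u ^+ 8 + 1 -> 1 <= eps * u ^+ 8 ->
  a * k ^+ 2 <= 3 * u ^+ 16 + k ^+ 2 * r -> 3 * u ^+ 8 <= eps * k ^+ 2 ->
  a <= (2 + 2 * eps) * u ^+ 8.
Proof.
move=> rle eu ak epsk.
have k2 : 0 < k ^+ 2 by rewrite exprn_gt0 // (lt_le_trans ltr01).
rewrite -(ler_pM2r k2); apply: le_trans ak _.
have -> : u ^+ 16 = u ^+ 8 * u ^+ 8 by rewrite -exprD.
have : 3 * u ^+ 8 * u ^+ 8 <= eps * k ^+ 2 * u ^+ 8.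
  by rewrite ler_wpM2r // exprn_ge0 // (le_trans ler01).
have : k ^+ 2 * r <= k ^+ 2 * (2 * u ^+ 8 + 1) by rewrite ler_wpM2l // ltW.
have : k ^+ 2 * 1 <= k ^+ 2 * (eps * u ^+ 8) by rewrite ler_wpM2l // ltW.
move: (u ^+ 8) (k ^+ 2) => s q; lra.
Qed.

Hypotheses (prod_le : (u ^+ 16 - 1) * rho <= k * a) (rho_gt0 : 0 < rho).
Hypothesis u_large : 2 <= u ^+ 16.

(** For small [k] the product [a k^2] is at most [12 u^16 / eps], and it is at least
    [k rho (u^16 - 1)]. Since [2 <= u ^+ 16], the constant 12 becomes 24. *)
Lemma fourth_moment_small r : r <= 2 * u ^+ 8 + 1 ->
  a * k ^+ 2 <= 3 * u ^+ 16 + k ^+ 2 * r -> eps * k ^+ 2 < 3 * u ^+ 8 ->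
  eps * (k * rho) <= 24.
Proof.
move=> rle ak epsk; have e0 := eps_gt0; have elt := eps_lt; have ul := u_large.
have u8 : 1 <= u ^+ 8 by exact: exprn_ege1.
have k2 : 0 <= k ^+ 2 by rewrite sqr_ge0.
have u16 : u ^+ 16 = u ^+ 8 * u ^+ 8 by rewrite -exprD.
have h1 : k * ((u ^+ 16 - 1) * rho) <= a * k ^+ 2.
  have -> : a * k ^+ 2 = k * (k * a) by ring.
  by rewrite ler_wpM2l // (le_trans ler01).
have h2 : k ^+ 2 * r <= k ^+ 2 * (3 * u ^+ 8) by rewrite ler_wpM2l //; lra.
have h3 : eps * (k * ((u ^+ 16 - 1) * rho)) <= eps * (3 * u ^+ 16 + k ^+ 2 * (3 * u ^+ 8)).
  by rewrite ler_pM2l //; lra.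
have h4 : eps * k ^+ 2 * (3 * u ^+ 8) <= 3 * u ^+ 8 * (3 * u ^+ 8).
  by rewrite ler_wpM2r //; [lra | exact: ltW].
have h5 : eps * u ^+ 16 <= u ^+ 16.
  by rewrite ler_piMl //; [apply: le_trans u_large; lra | lra].
have h6 : eps * (k * rho) * (u ^+ 16 - 1) <= 12 * u ^+ 16.
  by move: h3 h4 h5; rewrite u16; move: (u ^+ 8) (k ^+ 2) => s q; lra.
have X0 : 0 <= eps * (k * rho) by rewrite !mulr_ge0 ?(ltW eps_gt0) ?(ltW rho_gt0) // (le_trans ler01).
by move: h6 X0 u_large; move: (eps * _) (u ^+ 16) => x y; nra.
Qed.

Hypothesis rho_ge : 1 <= rho * C * u.

(** Inserting the bound on [a] into [prod_le] and dividing by [rho u^16] gives [k rho >= 1] up to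
    [(1 + 48 C^4) / (eps u^4)]. *)
Lemma two_point_numeric : eps * k <= 24 * C * u -> 
  100 * (1 + 48 * C ^+ 4) <= eps * u ^+ 4 ->
  a <= u ^+ 16 * rho ^+ 2 + 2 * C ^+ 2 * u ^+ 10 -> 99 <= 100 * (k * rho).
Proof.
move=> epsk ularge a_le; have e0 := eps_gt0; have elt := eps_lt.
have k0 : 0 <= k by rewrite (le_trans ler01).
have u0 : 0 <= u by rewrite (le_trans ler01).
have h1 : (u ^+ 16 - 1) * rho <= k * (u ^+ 16 * rho ^+ 2 + 2 * C ^+ 2 * u ^+ 10).
  by apply: le_trans prod_le _; rewrite ler_wpM2l.
have h2 : k * (2 * C ^+ 2 * u ^+ 10) * 1 <= k * (2 * C ^+ 2 * u ^+ 10) * (rho * C * u).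
  by rewrite ler_wpM2l // !mulr_ge0 // ?exprn_ge0.
have h3 : u ^+ 16 - 1 <= k * rho * u ^+ 16 + 2 * k * C ^+ 3 * u ^+ 11.
  rewrite -(ler_pM2r rho_gt0).
  have -> : (k * rho * u ^+ 16 + 2 * k * C ^+ 3 * u ^+ 11) * rho =
    k * (u ^+ 16 * rho ^+ 2) + k * (2 * C ^+ 2 * u ^+ 10) * (rho * C * u) by ring.
  lra.
have h4 : eps * k * (2 * C ^+ 3 * u ^+ 11) <= 24 * C * u * (2 * C ^+ 3 * u ^+ 11).
  by rewrite ler_wpM2r // !mulr_ge0 // exprn_ge0.
have h5 : eps * (u ^+ 16 - 1) <= eps * (k * rho * u ^+ 16 + 2 * k * C ^+ 3 * u ^+ 11).
  by rewrite ler_pM2l.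
have h6 : 100 * (1 + 48 * C ^+ 4) * u ^+ 12 <= eps * u ^+ 4 * u ^+ 12.
  by rewrite ler_wpM2r // exprn_ge0.
have u12 : 1 <= u ^+ 12 by exact: exprn_ege1.
have e16 : 0 < eps * u ^+ 16 by rewrite mulr_gt0 // exprn_gt0 // (lt_le_trans ltr01).
rewrite -(ler_pM2l e16).
have E1 : 24 * C * u * (2 * C ^+ 3 * u ^+ 11) = 48 * C ^+ 4 * u ^+ 12 by ring.
have E2 : eps * u ^+ 4 * u ^+ 12 = eps * u ^+ 16 by ring.
have E3 : eps * (k * rho * u ^+ 16 + 2 * k * C ^+ 3 * u ^+ 11) =
   eps * u ^+ 16 * (k * rho) + eps * k * (2 * C ^+ 3 * u ^+ 11) by ring.
rewrite E1 in h4; rewrite E2 in h6; rewrite E3 in h5.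
move: h4 h5 h6 u12; rewrite [_ * (100 * _)]mulrCA.
move: (eps * k * _) (eps * u ^+ 16 * (k * rho)) (C ^+ 4) => x y c.
have -> : eps * (u ^+ 16 - 1) = eps * u ^+ 16 - eps by ring.
move: (eps * u ^+ 16) (u ^+ 12) => z w h4 h5 h6 u12.
have -> : z * 99 = 99 * z by ring.
lra.
Qed.

Hypothesis E_le : E <= 18 * u ^+ 12.
Hypothesis krho : 99 <= 100 * (k * rho).

(** By [prod_le] and [krho], [a k^2] is at least about [0.99 u^16], while the pattern bound allows
    [25/32 u^16] and a lower-order term. The ratio [25/32] is [k^2 / 2^k] at [k = 5]. *)
Lemma pattern_numeric (x : K) : 0 < x -> 32 * k ^+ 2 <= 25 * x -> eps * k <= 24 * C * u ->
  x * a <= u ^+ 16 + x * E ->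
  100 * (1 + (110 * C) ^+ 2) <= eps ^+ 2 * u ^+ 2 -> False.
Proof.
move=> x0 xk epsk xa ularge; have e0 := eps_gt0; have elt := eps_lt.
have e1 : eps ^+ 2 <= 1 by rewrite expr_le1 ?(ltW e0) //; lra.
have kr := krho; have ul := u_large; have El := E_le.
have k0 : 0 <= k by rewrite (le_trans ler01).
have u0 : 0 <= u by rewrite (le_trans ler01).
have h1 : 99 * (u ^+ 16 - 1) <= 100 * (a * k ^+ 2).
  have : k * ((u ^+ 16 - 1) * rho) <= k * (k * a) by rewrite ler_wpM2l.
  have : 99 * (u ^+ 16 - 1) <= 100 * (k * rho) * (u ^+ 16 - 1) by rewrite ler_wpM2r //; lra.
  have -> : 100 * (k * rho) * (u ^+ 16 - 1) = 100 * (k * ((u ^+ 16 - 1) * rho)) by ring.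
  have -> : a * k ^+ 2 = k * (k * a) by ring.
  lra.
have aE : x * (a - E) <= u ^+ 16 by rewrite mulrBr; lra.
have h2 : 32 * (k ^+ 2 * (a - E)) <= 25 * u ^+ 16.
  have [aE0|aE0] := lerP (a - E) 0.
    have : k ^+ 2 * (a - E) <= 0 by rewrite mulr_ge0_le0 // sqr_ge0.
    by have := u_large; lra.
  have : 32 * k ^+ 2 * (a - E) <= 25 * x * (a - E) by rewrite ler_pM2r.
  by move: aE; move: (k ^+ 2) => q; lra.
have h3 : k ^+ 2 * E <= k ^+ 2 * (18 * u ^+ 12) by rewrite ler_wpM2l // sqr_ge0.
have h4 : (eps * k) ^+ 2 <= (24 * C * u) ^+ 2.
  by rewrite ler_pXn2r // nnegrE !mulr_ge0 // ltW.
have e2 : 0 < eps ^+ 2 by rewrite exprn_gt0.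
have h5 : eps ^+ 2 * (k ^+ 2 * (18 * u ^+ 12)) <= (24 * C * u) ^+ 2 * (18 * u ^+ 12).
  have -> : eps ^+ 2 * (k ^+ 2 * (18 * u ^+ 12)) = (eps * k) ^+ 2 * (18 * u ^+ 12) by ring.
  by rewrite ler_wpM2r // mulr_ge0 // exprn_ge0.
have h6 : 100 * (1 + (110 * C) ^+ 2) * u ^+ 14 <= eps ^+ 2 * u ^+ 2 * u ^+ 14.
  by rewrite ler_wpM2r // exprn_ge0.
have h7 : 990 * (u ^+ 16 - 1) <= 800 * u ^+ 16 + 1000 * (k ^+ 2 * (18 * u ^+ 12)).
  move: h1 h2 h3 ul; rewrite [k ^+ 2 * (a - E)]mulrBr [a * _]mulrC.
  move: (k ^+ 2 * a) (k ^+ 2 * E) (k ^+ 2 * _) (u ^+ 16) => *; lra.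
have h8 : eps ^+ 2 * (190 * u ^+ 16) <= eps ^+ 2 * (990 + 1000 * (k ^+ 2 * (18 * u ^+ 12))).
  by rewrite ler_pM2l //; lra.
have E1 : (24 * C * u) ^+ 2 * (18 * u ^+ 12) = 24 * 24 * 18 * (C ^+ 2 * u ^+ 14) by ring.
have E2 : eps ^+ 2 * u ^+ 2 * u ^+ 14 = eps ^+ 2 * u ^+ 16 by ring.
have E3 : 100 * (1 + (110 * C) ^+ 2) * u ^+ 14 = 100 * u ^+ 14 + 100 * 110 * 110 * (C ^+ 2 * u ^+ 14) by ring.
have u14 : 1 <= u ^+ 14 by exact: exprn_ege1.
have Cu : 0 <= C ^+ 2 * u ^+ 14 by rewrite mulr_ge0 ?sqr_ge0 ?exprn_ge0.
move: h5 h6 h8; rewrite E1 E2 E3 => h5 h6.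
have -> : eps ^+ 2 * (190 * u ^+ 16) = 190 * (eps ^+ 2 * u ^+ 16) by ring.
have -> : eps ^+ 2 * (990 + 1000 * (k ^+ 2 * (18 * u ^+ 12))) =
  990 * eps ^+ 2 + 1000 * (eps ^+ 2 * (k ^+ 2 * (18 * u ^+ 12))) by ring.
move: h5 h6 Cu u14 e1 => {h1 aE h2 h3 h4 h7}.
by move: (eps ^+ 2) (u ^+ 14) (C ^+ 2 * u ^+ 14) (eps ^+ 2 * u ^+ 16)
  (eps ^+ 2 * (k ^+ 2 * _)) => *; lra.
Qed.

(** To leading order the inequality reads [2^L rho + k - 1 <= k 2^(k - 1)]. With [rho] at least
    about [1 / k], the left side is at least about 5, 38/3 and 35 for [k] equal to 2, 3 and 4,
    against 4, 12 and 32 on the right. *)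
Lemma small_numeric (kn : nat) (L := (2 * kn - 1)%N) : k = kn%:R -> (1 < kn < 5)%N ->
  2 ^+ L * ((u ^+ 16 - 1) * rho) + (k - 1) * u ^+ 16 <=
    k * 2 ^+ kn.-1 * (u ^+ 16 + 2 ^+ kn * E) + (k - 1) * 2 ^+ L * (E + L%:R) ->
  100 * 100 <= u ^+ 4 -> False.
Proof.
move=> kE kn15 H u4; have kr := krho; have ul := u_large; have El := E_le.
have u12 : 1 <= u ^+ 12 by exact: exprn_ege1.
have u16 : 100 * 100 * u ^+ 12 <= u ^+ 16.
  have -> : u ^+ 16 = u ^+ 4 * u ^+ 12 by ring.
  by rewrite ler_wpM2r // ltW // (lt_le_trans ltr01).
have kr' : 99 * (u ^+ 16 - 1) <= 100 * (k * rho) * (u ^+ 16 - 1) by rewrite ler_wpM2r //; lra.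
move: H kr' ul El u12 u16; rewrite /L kE {L kr u4}.
move: (u ^+ 16) (u ^+ 12) => P Q.
case: kn kn15 kE => [|[|[|[|[|?]]]]] // _ kE.
- rewrite -[(2 * 2 - 1)%N]/3%N -[2.-1]/1%N; lra.
- rewrite -[(2 * 3 - 1)%N]/5%N -[3.-1]/2%N; lra.
- rewrite -[(2 * 4 - 1)%N]/7%N -[4.-1]/3%N; lra.
Qed.

End Numeric.

(** * The upper bound for a summand *)

Lemma sq_le_exp2 k : (5 <= k)%N -> (32 * k ^ 2 <= 25 * 2 ^ k)%N.
Proof.
elim: k => // k IH; rewrite leq_eqVlt => /orP[/eqP <-//|k5].
by have := IH k5; rewrite [(2 ^ k.+1)%N]expnS -!mulnn; move: (2 ^ k)%N => x; nia.
Qed.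

Lemma cube_le_exp2 v : (v ^ 3 <= 48 * 2 ^ v)%N.
Proof.
elim: v => // v IH; have [v4|v4] := ltnP v 4; first by case: v v4 {IH} => [|[|[|[|]]]].
move: IH; rewrite [(2 ^ v.+1)%N]expnS !(expnS _ 2) -!mulnn; move: (2 ^ v)%N => x; nia.
Qed.

Section Main.
Variable F : finFieldType.
Hypotheses (F_prime : prime #|F|) (F_gt2 : (2 < #|F|)%N).
Local Notation p := #|F|.
Local Notation n := (#|F|.-1).
Local Notation P := [set x : F | n.-primitive_root x].

(** The bound of [char_sum_bound] for [J = v ^ 5]. With [v] about [p^(1/16)], the product [J^2 v]
    stays below [p] as required, and the error has order [p / v^4], that is [p^(3/4)]. *)
Definition char_err (v : nat) : nat := 2 * v + (v * p) %/ v ^ 5.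

Lemma char_sum_err v (V : seq F) : (3 <= v)%N -> (v ^ 16 <= p)%N ->
  uniq V -> (0 < size V <= v)%N -> `|\sum_x \prod_(s <- V) qc (x + s)| <= (char_err v)%:Z.
Proof.
move=> v3 vp uV /andP[V0 Vv].
have v5 : (0 < v ^ 5)%N by rewrite expn_gt0 (leq_trans _ v3).
have Jp : (12 * (v ^ 5) ^ 2 * size V + size V + 2 <= p)%N.
  apply: leq_trans vp; rewrite -expnM /=.
  have : (12 * v ^ 10 * size V <= 12 * v ^ 10 * v)%N by rewrite leq_mul2l Vv orbT.
  have -> : (v ^ 16 = v ^ 5 * (v ^ 10 * v))%N by rewrite -expnSr -expnD.
  have -> : (12 * v ^ 10 * v = 12 * (v ^ 10 * v))%N by rewrite mulnA.
  have : (243 <= v ^ 5)%N by rewrite -[243%N]/(3 ^ 5)%N leq_exp2r.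
  have : (v <= v ^ 10 * v)%N by rewrite leq_pmull // expn_gt0 (leq_trans _ v3).
  by move: v3 Vv; move: (size V) (v ^ 5)%N (v ^ 10 * v)%N (12 * v ^ 10 * _)%N => a b c d; nia.
have := char_sum_bound F_prime F_gt2 uV V0 v5 Jp.
case: (`|_|) => // r; rewrite -PoszM -PoszD !lez_nat => rle.
rewrite /char_err -leq_subLR leq_divRL // mulnBl leq_subLR.
by move: rle Vv; move: (v ^ 5)%N (size V) p => J m q; nia.
Qed.

Variable K : realFieldType.

Lemma char_err_le (u : K) v : (0 < v)%N -> v%:R <= u -> u <= 2 * v%:R ->
  u ^+ 16 = p%:R -> (char_err v)%:R <= 18 * u ^+ 12 :> K.
Proof.
move=> v0 vu uv up; have v1 : 1 <= v%:R :> K by rewrite ler1n.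
have u1 : 1 <= u by exact: le_trans vu.
rewrite /char_err; set e := (_ %/ _)%N.
have ev : (e * v ^ 5 <= v * p)%N by exact: leq_divM.
have {}ev : e%:R * v%:R ^+ 4 <= u ^+ 16 :> K.
  rewrite up -natrX -natrM ler_nat -(leq_pmul2l v0) (leq_trans _ ev) //.
  by rewrite mulnCA -expnS.
have u12 : u <= u ^+ 12 by rewrite ler_eXnr.
have e_le : e%:R <= 16 * u ^+ 12.
  rewrite -(ler_pM2r (_ : 0 < u ^+ 4)); last by rewrite exprn_gt0 // (lt_le_trans ltr01).
  have -> : 16 * u ^+ 12 * u ^+ 4 = 16 * u ^+ 16 by ring.
  apply: le_trans (_ : e%:R * (2 * v%:R) ^+ 4 <= _).
    by rewrite ler_wpM2l // lerXn2r ?nnegrE ?mulr_ge0 // (le_trans ler01).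
  have -> : e%:R * (2 * v%:R) ^+ 4 = 16 * (e%:R * v%:R ^+ 4) :> K by ring.
  by rewrite ler_pM2l.
by rewrite natrD natrM; move: vu e_le u12; lra.
Qed.

(* [u] is [p^(1/16)] and [v] its integer part. *)
Variables (A B : {set F}) (eps u : K) (C v : nat).
Hypotheses (sumAB : [set a + b | a in A, b in B] = P).
Hypotheses (A_gt0 : (0 < #|A|)%N) (B_gt1 : (1 < #|B|)%N).
Hypotheses (eps_gt0 : 0 < eps) (eps_lt : eps < 1 / 2) (up : u ^+ 16 = p%:R).
Hypotheses (v_ge7 : (7 <= v)%N) (vu : v%:R <= u) (uv : u <= 2 * v%:R).
Hypothesis C_omega : forall m, (0 < m)%N ->
  ((2 ^ size (primes m)) ^ 16 <= C ^ 16 * m)%N.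
Hypotheses (u_1 : 1 <= eps * u ^+ 8) (u_2 : 100 * (1 + 48 * C%:R ^+ 4) <= eps * u ^+ 4).
Hypotheses (u_3 : 100 * (1 + (110 * C%:R) ^+ 2) <= eps ^+ 2 * u ^+ 2).
Hypotheses (u_4 : 32 * (24 * C%:R * u) ^+ 2 <= eps ^+ 2 * (25 * 2 ^+ v)).
Hypotheses (u_5 : 100 * 100 <= u ^+ 4).

Let rho : K := \prod_(q <- primes n) (1 - q%:R^-1).

Let u_ge1 : 1 <= u.
Proof. by apply: le_trans vu; rewrite ler1n (leq_trans _ v_ge7). Qed.

Let n_gt0 : (0 < n)%N.
Proof. by move: F_gt2; move: p => [|[]]. Qed.

Let pn : p%:R = n%:R + 1 :> K.
Proof. by rewrite natr1 prednK // (leq_trans _ F_gt2). Qed.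

Lemma omega_le : 2 ^+ size (primes n) <= C%:R * u :> K.
Proof.
have u0 : 0 <= u by rewrite (le_trans ler01).
rewrite -(ler_pXn2r (n := 16)) ?nnegrE ?exprn_ge0 ?mulr_ge0 // exprMn up.
rewrite -!natrX -natrM ler_nat (leq_trans (C_omega n_gt0)) // leq_mul2l leq_pred orbT //.
Qed.

(** Each factor [1 - 1 / q] is at least [1 / 2]. *)
Lemma rho_ge_omega : 1 <= rho * 2 ^+ size (primes n).
Proof.
rewrite /rho; have : all (fun q => 2 <= q)%N (primes n).
  by apply/allP => q; rewrite mem_primes => /and3P[/prime_gt1].
elim: (primes n) => [|q r IH] /=; first by rewrite big_nil mulr1.
move=> /andP[q2 /IH {}IH]; rewrite big_cons exprS mulrACA -[leLHS]mulr1.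
apply: ler_pM => //; rewrite mulrBl mul1r.
have q0 : 0 < q%:R :> K by rewrite ltr0n (leq_trans _ q2).
have : q%:R^-1 * 2 <= 1 :> K by rewrite mulrC ler_pdivrMr // mul1r ler_nat.
lra.
Qed.

Lemma rho_gt0 : 0 < rho.
Proof.
have := rho_ge_omega; have : 0 < 2 ^+ size (primes n) :> K by rewrite exprn_gt0.
by move=> h1 h2; rewrite -(pmulr_lgt0 _ h1) (lt_le_trans ltr01).
Qed.

Lemma main_bound : (#|A|)%:R <= (2 + 2 * eps) * u ^+ 8.
Proof.
set a := (#|A|)%:R; pose k := (#|B|)%:R : K.
have u0 : 0 <= u by exact: le_trans ler01 u_ge1.
have a0 : 0 <= a by exact: ler0n.
have k1 : 1 <= k by rewrite ler1n ltnW.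
have rho0 := rho_gt0.
have s2 : (u ^+ 8) ^+ 2 = p%:R by rewrite -exprM.
have [r r_le moment] := fourth_moment_card F_prime F_gt2 sumAB A_gt0 B_gt1.
have {}r_le : r%:R <= 2 * u ^+ 8 + 1.
  rewrite -(ler_pXn2r (n := 2)) ?nnegrE ?addr_ge0 ?mulr_ge0 ?exprn_ge0 //.
  have : (r ^ 2)%:R <= (4 * p + 1)%:R :> K by rewrite ler_nat.
  rewrite natrX natrD natrM -s2 => /le_trans; apply.
  have : 0 <= u ^+ 8 by exact: exprn_ge0.
  by move: (u ^+ 8) => x; nra.
have {}moment : a * k ^+ 2 <= 3 * u ^+ 16 + k ^+ 2 * r%:R.
  by rewrite up -natrX -!natrM -natrD ler_nat.
have [epsk|epsk] := lerP (3 * u ^+ 8) (eps * k ^+ 2).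
  exact: (fourth_moment_large u_ge1 k1 r_le u_1 moment epsk).
exfalso.
have totE : (totient n)%:R = (u ^+ 16 - 1) * rho by rewrite totient_prod // up pn addrK.
have prod_le : (u ^+ 16 - 1) * rho <= k * a.
  by rewrite -totE -natrM ler_nat mulnC card_product.
have u16 : 2 <= u ^+ 16 by rewrite up ler_nat ltnW.
have ek := fourth_moment_small eps_gt0 eps_lt u_ge1 k1 prod_le rho0 u16 r_le moment epsk.
have rhoC : 1 <= rho * C%:R * u.
  by apply: le_trans rho_ge_omega _; rewrite -mulrA ler_pM2l // omega_le.
have epsk1 : eps * k <= 24 * C%:R * u.
  have : eps * k * 1 <= eps * k * (rho * C%:R * u).
    by rewrite ler_wpM2l // mulr_ge0 ?(ltW eps_gt0) // (le_trans ler01).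
  rewrite mulr1 => /le_trans; apply.
  have -> : eps * k * (rho * C%:R * u) = eps * (k * rho) * (C%:R * u) by ring.
  by rewrite -[24 * _ * _]mulrA ler_wpM2r // mulr_ge0.
have a_le : a <= u ^+ 16 * rho ^+ 2 + 2 * C%:R ^+ 2 * u ^+ 10.
  apply: le_trans (two_point_card sumAB B_gt1 (exprn_ge0 8 u0) s2) _.
  apply: lerD.
    by rewrite up ler_wpM2r ?sqr_ge0 // gerBl.
  have -> : 2 * C%:R ^+ 2 * u ^+ 10 = C%:R * u * (C%:R * u * (2 * u ^+ 8)) by ring.
  have w0 : 0 <= 2 ^+ size (primes n) :> K by rewrite exprn_ge0.
  have u80 : 0 <= 2 * u ^+ 8 by rewrite mulr_ge0 // exprn_ge0.
  by apply: ler_pM; rewrite ?mulr_ge0 ?omega_le // ler_wpM2r // omega_le.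
have C0 : 0 <= C%:R :> K by exact: ler0n.
have krho := two_point_numeric eps_gt0 eps_lt u_ge1 k1 C0 prod_le rho0 rhoC epsk1 u_2 a_le.
have vp : (v ^ 16 <= p)%N.
  by rewrite -(ler_nat K) natrX -up lerXn2r ?nnegrE.
have E_bound (V : seq F) : uniq V -> (0 < size V <= v)%N ->
    `|\sum_x \prod_(s <- V) qc (x + s)| <= (char_err v)%:Z.
  by apply: char_sum_err => //; exact: leq_trans v_ge7.
have E_le : (char_err v)%:R <= 18 * u ^+ 12 :> K.
  by apply: char_err_le => //; exact: leq_trans v_ge7.
have [k5|k5] := ltnP #|B| 5; last first.
  (* The character sums are controlled for at most [v] shifts, so at most [v] elements of [B] are
     used. If [B] is larger, [2 ^+ v] still dominates [k ^+ 2] by [u_4], since [k] is at most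
     [24 C u / eps]. *)
  pose j := minn #|B| v; pose U := take j (enum B).
  have sU : size U = j by rewrite size_take -cardE /j; case: ltngtP (geq_minl #|B| v).
  have uU : uniq U by rewrite take_uniq ?enum_uniq.
  have UB : {subset U <= B} by move=> b /mem_take; rewrite mem_enum.
  have U0 : (0 < size U <= v)%N.
    by rewrite sU /j geq_minr leq_min (ltnW B_gt1) (leq_trans _ v_ge7).
  have [W_le _] := pattern_card F_prime F_gt2 E_bound uU U0.
  have aW : (#|A| <= #|pattern U|)%N.
    apply: subset_leq_card; exact: (sub_pattern F_prime F_gt2 sumAB A_gt0 B_gt1 UB).
  apply: (pattern_numeric eps_gt0 eps_lt u_ge1 k1 C0 prod_le u16 E_le krho
    (x := 2 ^+ j)) => //; first by rewrite exprn_gt0.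
  - rewrite /j /minn; case: ltnP => _.
      by rewrite -!natrX -!natrM ler_nat sq_le_exp2.
    have e2 : 0 < eps ^+ 2 by rewrite exprn_gt0.
    rewrite -(ler_pM2l e2); apply: le_trans u_4.
    have -> : eps ^+ 2 * (32 * k ^+ 2) = 32 * (eps * k) ^+ 2 by ring.
    by rewrite ler_pM2l // lerXn2r // nnegrE !mulr_ge0 // ltW // (lt_le_trans ltr01).
  - apply: le_trans (_ : 2 ^+ j * (#|pattern U|)%:R <= _).
      by rewrite ler_wpM2l ?exprn_ge0 // ler_nat.
    move: W_le; rewrite sU -(ler_int K) !(rmorphD, rmorphM, rmorphXn) /=.
    by rewrite -!pmulrn up.
(* Here [#|B| <= 4], so the overlaps involve at most 7 shifts, whence the assumption [7 <= v]. *)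
have Lv : (2 * #|B| - 1 <= v)%N.
  by apply: leq_trans v_ge7; rewrite leq_subLR -[(1 + 7)%N]/(2 * 4)%N leq_mul2l.
have cov := cover_bound F_prime F_gt2 sumAB A_gt0 B_gt1 E_bound Lv.
apply: (small_numeric u_ge1 u16 E_le krho (kn := #|B|)) => //; first by rewrite B_gt1.
move: cov; rewrite -(ler_int K) !(rmorphD, rmorphB, rmorphM, rmorphXn, rmorph1) /=.
by rewrite -!pmulrn totE up.
Qed.

End Main.

(** * How large [p] has to be *)

Lemma omega_bound (b : nat) : exists C : nat, forall m : nat, (0 < m)%N ->
  ((2 ^ size (primes m)) ^ b <= C ^ b * m)%N.
Proof.
exists (2 ^ (2 ^ b))%N => m m0.
by rewrite -!expnM ![(_ * b)%N]mulnC !expnM; exact: two_exp_primes.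
Qed.

Section Thresholds.
Variables (K : realFieldType) (eps : K) (C : nat).
Hypothesis eps_gt0 : 0 < eps.

(** A sum of nonnegative terms, so that a single inequality [threshold <= u] yields all the lower
    bounds on [u]. *)
Definition threshold : K := 100 + eps^-1 + 100 * (1 + 48 * C%:R ^+ 4) / eps
  + 100 * (1 + (110 * C%:R) ^+ 2) / eps ^+ 2 + 384 * 32 * (24 * C%:R) ^+ 2 / eps ^+ 2.

Lemma thresholdP u v : threshold <= u -> v%:R <= u -> u < v.+1%:R ->
  [/\ (7 <= v)%N, u <= 2 * v%:R, 1 <= eps * u ^+ 8,
    100 * (1 + 48 * C%:R ^+ 4) <= eps * u ^+ 4 &
    [/\ 100 * (1 + (110 * C%:R) ^+ 2) <= eps ^+ 2 * u ^+ 2,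
      32 * (24 * C%:R * u) ^+ 2 <= eps ^+ 2 * (25 * 2 ^+ v) & 100 * 100 <= u ^+ 4]].
Proof.
move=> hu vu uv.
have C0 : 0 <= C%:R :> K by exact: ler0n.
have e2 : 0 < eps ^+ 2 by rewrite exprn_gt0.
have t1 : 0 <= eps^-1 by rewrite invr_ge0 ltW.
have t2 : 0 <= 100 * (1 + 48 * C%:R ^+ 4) / eps.
  by rewrite divr_ge0 ?(ltW eps_gt0) // mulr_ge0 // addr_ge0 // mulr_ge0 // exprn_ge0.
have t3 : 0 <= 100 * (1 + (110 * C%:R) ^+ 2) / eps ^+ 2.
  by apply: divr_ge0 (ltW e2); apply: mulr_ge0 => //; apply: addr_ge0 => //; exact: sqr_ge0.
have t4 : 0 <= 384 * 32 * (24 * C%:R) ^+ 2 / eps ^+ 2.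
  by apply: divr_ge0 (ltW e2); apply: mulr_ge0; [exact: mulr_ge0 | exact: sqr_ge0].
have [u100 k1 k2 [k3 k4]] : [/\ 100 <= u, eps^-1 <= u, 100 * (1 + 48 * C%:R ^+ 4) / eps <= u &
    100 * (1 + (110 * C%:R) ^+ 2) / eps ^+ 2 <= u /\ 384 * 32 * (24 * C%:R) ^+ 2 / eps ^+ 2 <= u].
  move: hu t1 t2 t3 t4; rewrite /threshold.
  move: eps^-1 (100 * (1 + 48 * C%:R ^+ 4) / eps) (100 * (1 + (110 * C%:R) ^+ 2) / eps ^+ 2)
    (384 * 32 * (24 * C%:R) ^+ 2 / eps ^+ 2) => *.
  by do !split; lra.
have u1 : 1 <= u by lra.
have u0 : 0 <= u by lra.
have h1 : 1 <= eps * u by rewrite [leRHS]mulrC -ler_pdivrMr // div1r.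
have h2 : 100 * (1 + 48 * C%:R ^+ 4) <= eps * u by rewrite [leRHS]mulrC -ler_pdivrMr.
have h3 : 100 * (1 + (110 * C%:R) ^+ 2) <= eps ^+ 2 * u by rewrite [leRHS]mulrC -ler_pdivrMr.
have h4 : 384 * 32 * (24 * C%:R) ^+ 2 <= eps ^+ 2 * u by rewrite [leRHS]mulrC -ler_pdivrMr.
have up k : (0 < k)%N -> u <= u ^+ k by move=> k0; rewrite ler_eXnr.
have v7 : (7 <= v)%N by rewrite -ltnS -(ltr_nat K); lra.
have u2v : u <= 2 * v%:R.
  by move: uv; rewrite -natr1; have : 7 <= v%:R :> K by [rewrite ler_nat]; lra.
split=> //.
- by apply: le_trans h1 _; rewrite ler_pM2l // up.
- by apply: le_trans h2 _; rewrite ler_pM2l // up.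
split; last 1 first.
- rewrite -[100 * 100]/(100 ^+ 2) (le_trans (_ : _ <= u ^+ 2)) //.
    by rewrite lerXn2r // nnegrE.
  by rewrite ler_weXn2l.
- by apply: le_trans h3 _; rewrite ler_pM2l // up.
(* Here [384 = 8 * 48], from [u <= 2 v] and [cube_le_exp2]. The spare factor [u] in [u ^+ 3] then
   absorbs the constants. *)
have cube : u ^+ 3 <= 384 * 2 ^+ v.
  apply: le_trans (_ : (2 * v%:R) ^+ 3 <= _); first by rewrite lerXn2r // nnegrE mulr_ge0.
  have : v%:R ^+ 3 <= 48 * 2 ^+ v :> K by rewrite -!natrX -natrM ler_nat cube_le_exp2.
  have -> : (2 * v%:R) ^+ 3 = 8 * v%:R ^+ 3 :> K by ring.
  lra.
have h5 : 384 * 32 * (24 * C%:R) ^+ 2 * u ^+ 2 <= eps ^+ 2 * u * u ^+ 2.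
  by rewrite ler_wpM2r // sqr_ge0.
have h6 : eps ^+ 2 * u ^+ 3 <= eps ^+ 2 * (384 * 2 ^+ v) by rewrite ler_pM2l.
have w0 : 0 <= eps ^+ 2 * 2 ^+ v by rewrite mulr_ge0 ?(ltW e2) ?exprn_ge0.
have -> : eps ^+ 2 * (25 * 2 ^+ v) = 25 * (eps ^+ 2 * 2 ^+ v) by ring.
have -> : 32 * (24 * C%:R * u) ^+ 2 = 32 * (24 * C%:R) ^+ 2 * u ^+ 2 by ring.
move: h5 h6.
have -> : eps ^+ 2 * u * u ^+ 2 = eps ^+ 2 * u ^+ 3 by ring.
have -> : eps ^+ 2 * (384 * 2 ^+ v) = 384 * (eps ^+ 2 * 2 ^+ v) by ring.
have -> : 384 * 32 * (24 * C%:R) ^+ 2 * u ^+ 2 = 384 * (32 * (24 * C%:R) ^+ 2 * u ^+ 2) by ring.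
move: (32 * _ * _) (eps ^+ 2 * u ^+ 3) (eps ^+ 2 * 2 ^+ v) w0 => x y z; lra.
Qed.

End Thresholds.

(** * Bounds for both summands, and transfer to the real numbers *)

Lemma sumsetC p (A B : {set 'F_p}) : sumset A B = sumset B A.
Proof.
by apply/setP => x; apply/imset2P/imset2P => -[a b aA bB ->]; exists b a; rewrite // addrC.
Qed.

Lemma card_summand_le (K : archiRcfType) (eps : K) : 0 < eps -> eps < 1 / 2 ->
  exists p0 : nat, forall p : nat, prime p -> (p0 < p)%N ->
  forall A B : {set 'F_p}, (2 <= #|A|)%N -> (2 <= #|B|)%N ->
    sumset A B = primitive_elts p -> (#|A|)%:R <= (2 + 2 * eps) * Num.sqrt (p%:R : K).
Proof.
move=> e0 e1; have [C C_omega] := omega_bound 16.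
pose U : K := threshold eps C.
(* The first term ensures [U <= p^(1/16)], the second [2 < p]. *)
exists (Num.truncn (U ^+ 16) + 2)%N => p p_pr p_gt A B A2 B2 sumAB.
pose u : K := Num.sqrt (Num.sqrt (Num.sqrt (Num.sqrt p%:R))).
have u0 : 0 <= u by exact: sqrtr_ge0.
have u8 : u ^+ 8 = Num.sqrt p%:R.
  by rewrite (exprM u 2 4) (exprM _ 2 2) !sqr_sqrtr ?sqrtr_ge0.
have u16 : u ^+ 16 = p%:R by rewrite (exprM u 8 2) u8 sqr_sqrtr.
have Uu : U <= u.
  have [U0|U0] := lerP U 0; first exact: le_trans u0.
  rewrite -(ler_pXn2r (n := 16)) ?nnegrE ?(ltW U0) // u16.
  have /truncn_itv/andP[_ /ltW] : 0 <= U ^+ 16 by rewrite exprn_ge0 // ltW.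
  by move/le_trans; apply; rewrite ler_nat -addn1 (leq_trans _ (ltnW p_gt)) // leq_add2l.
have /andP[vu uv] := truncn_itv u0.
have [v7 u2v h1 h2 [h3 h4 h5]] := thresholdP e0 Uu vu uv.
have p2 : (2 < p)%N by rewrite (leq_trans _ p_gt) // addn2.
have cF := card_Fp p_pr.
have F_prime : prime #|'F_p| by rewrite cF.
have F_gt2 : (2 < #|'F_p|)%N by rewrite cF.
rewrite -u8; apply: (@main_bound 'F_p F_prime F_gt2 K A B eps u C (Num.truncn u)) => //.
- by rewrite -[LHS]/(sumset A B) sumAB cF.
- exact: ltnW.
- by rewrite cF.
Qed.

(** The upper bound follows from [2 + 2 eps <= 3]. The lower bound combines
    [totient p.-1 <= #|A| * #|B|], the upper bound for [B] and [(1/2 - eps) (2 + 2 eps) <= 1]. *)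
Lemma card_summands_bounds (K : archiRcfType) (eps : K) : 0 < eps -> eps < 1 / 2 ->
  exists p0 : nat, forall p : nat, prime p -> (p0 < p)%N ->
  forall A B : {set 'F_p}, (2 <= #|A|)%N -> (2 <= #|B|)%N ->
    sumset A B = primitive_elts p ->
    ((1 / 2 - eps) * (totient p.-1)%:R / Num.sqrt (p%:R : K) <= (#|A|)%:R) /\
    (#|A|)%:R <= 3 * Num.sqrt (p%:R : K).
Proof.
move=> e0 e1; have [p0 H] := card_summand_le e0 e1.
exists (p0 + 2)%N => p p_pr p_gt A B A2 B2 sumAB.
have p0p : (p0 < p)%N by rewrite (leq_trans _ p_gt) // ltnS leq_addr.
have p2 : (2 < p)%N by rewrite (leq_trans _ p_gt) // ltnS leq_addl.
have A_le := H p p_pr p0p A B A2 B2 sumAB.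
have B_le : (#|B|)%:R <= (2 + 2 * eps) * Num.sqrt p%:R.
  by apply: (H p p_pr p0p B A) => //; rewrite sumsetC.
have cF := card_Fp p_pr.
have sp : 0 < Num.sqrt p%:R :> K by rewrite sqrtr_gt0 ltr0n prime_gt0.
split; last by apply: le_trans A_le _; rewrite ler_pM2r //; lra.
rewrite ler_pdivrMr //.
have tot : (totient p.-1)%:R <= (#|A|)%:R * (#|B|)%:R :> K.
  have : (totient #|'F_p|.-1 <= #|A| * #|B|)%N.
    apply: card_product; [|exact: ltnW|exact: B2].
    by rewrite -[LHS]/(sumset A B) sumAB cF.
  by rewrite cF -natrM ler_nat.
have c0 : 0 <= 1 / 2 - eps by lra.
apply: le_trans (_ : (1 / 2 - eps) * ((#|A|)%:R * ((2 + 2 * eps) * Num.sqrt p%:R)) <= _).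
  by rewrite ler_wpM2l // (le_trans tot) // ler_wpM2l.
have -> : (1 / 2 - eps) * ((#|A|)%:R * ((2 + 2 * eps) * Num.sqrt p%:R)) =
  (1 / 2 - eps) * (2 + 2 * eps) * ((#|A|)%:R * Num.sqrt p%:R) by ring.
rewrite ler_piMl ?mulr_ge0 ?(ltW sp) //; nra.
Qed.

(* Not earlier, because [Reals] rebinds the scope key [%R]. *)
From mathcomp Require Import Rstruct.
From Stdlib Require Import Reals.
Close Scope ring_scope.

Theorem theorem1p2 :
  forall eps : R, (0 < eps < 1/2)%R ->
  exists p0 : nat, forall p : nat, prime p -> (p0 < p)%N ->
  forall A B : {set 'F_p}, (2 <= #|A|)%N -> (2 <= #|B|)%N ->
    sumset A B = primitive_elts p ->
    ((1/2 - eps) * INR (totient p.-1) / sqrt (INR p) <= INR #|A|)%R /\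
    (INR #|A| <= 3 * sqrt (INR p))%R /\
    ((1/2 - eps) * INR (totient p.-1) / sqrt (INR p) <= INR #|B|)%R /\
    (INR #|B| <= 3 * sqrt (INR p))%R.
Proof.
move=> eps [/RltP e0 /RltP e1]; rewrite ?RealsE in e0 e1.
have [p0 H] := @card_summands_bounds R eps e0 e1.
exists p0 => p p_pr p_gt A B A2 B2 sumAB.
have [A1 A3] := H p p_pr p_gt A B A2 B2 sumAB.
have [B1 B3] : _ /\ _ := H p p_pr p_gt B A B2 A2 (etrans (sumsetC B A) sumAB).
by do !split; apply/RleP; rewrite ?RealsE.
Qed.
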